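(* Let the continued fraction $$\varphi(z)=\cfrac{\alpha_0}{1-\cfrac{\alpha_1z}{1-\cfrac{\alpha_2z}{1-\cdots}}}$$ be non-terminating (all $\alpha_n\ne0$) with real coefficients satisfying $\sup_n|\alpha_n|<\infty$. If there exists $m\in\mathbb N$ such that $\alpha_n>0$ for all $n>2m$, then $\varepsilon_0\varphi\in\mathcal N_\kappa^\lambda$ and $-\varepsilon_0\varphi\notin\mathfrak N$, where $$\varepsilon_j=\operatorname{sign}\prod_{k=j}^{2m}\alpha_k=\prod_{k=j}^\infty\operatorname{sign}\alpha_k,$$ and $\lambda$ and $\kappa$ are the numbers of negative entries in the sequences $\varepsilon_1,\varepsilon_3,\dots,\varepsilon_{2m-1}$ and $\varepsilon_2,\varepsilon_4,\dots,\varepsilon_{2m}$, respectively. Conversely, $\varepsilon\varphi\notin\mathfrak S$ for both $\varepsilon\in\{-1,1\}$ if and only if there are arbitrarily large $n$ such that $\alpha_n<0$.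
   Context: $\mathbb N_0=\{0,1,2,\dots\}$, $\mathbb N=\{1,2,\dots\}$, $\mathbb C_+=\{z:\operatorname{Im}z>0\}$. For points $z_1,\dots,z_n\in\mathbb C_+$ that are not poles of $f$, the Pick matrix is $H_f(z_1,\dots,z_n)=\left[\frac{f(z_k)-\overline{f(z_j)}}{z_k-\overline{z_j}}\right]_{k,j=1}^n$. For $\kappa\in\mathbb N_0$, $f\in\mathcal N_\kappa$ means that $f$ is meromorphic in $\mathbb C_+$ (and extended to the lower half-plane by the symmetry $f(\overline z)=\overline{f(z)}$), that $H_f(z_1,\dots,z_n)$ has at most $\kappa$ negative eigenvalues for every $n\in\mathbb N$ and every choice of points, and exactly $\kappa$ for some choice. $f\in\mathcal N_\kappa^\lambda$ means $f\in\mathcal N_\kappa$ and $zf(z)\in\mathcal N_\lambda$. $\mathfrak N=\bigcup_{\kappa\ge0}\mathcal N_\kappa$ and $\mathfrak S=\bigcup_{\kappa,\lambda\ge0}\mathcal N_\kappa^\lambda$. When $\sup_n|\alpha_n|<\infty$ the continued fraction converges uniformly in a neighbourhood of $z=0$ to an analytic function; $\varphi$ is identified with this function and with its meromorphic continuation to $\mathbb C\setminus\mathbb R$ (when it exists). The statement that $\pm\varphi$ belongs to one of the classes means that such a continuation exists and belongs to the class. *)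

(* Defs.v *)
From HB Require Import structures.
From mathcomp Require Import all_boot all_order all_algebra.
From mathcomp Require Import complex.
From mathcomp Require Import all_classical all_reals all_analysis.

Set Implicit Arguments.
Unset Strict Implicit.
Unset Printing Implicit Defensive.

Import Order.TTheory GRing.Theory Num.Theory.
Import numFieldNormedType.Exports.

Local Open Scope classical_set_scope.
Local Open Scope ring_scope.

(* The topology and the normed space structure of the complex numbers are
   inferred on the regular module [R[i]^o] (scalars in [R[i]]), so [derivable]
   below is complex differentiability. *)

Definition holomorphic_at (R : realType) (f : R[i] -> R[i]) (a : R[i]) : Prop :=
  \forall w \near (a : R[i]^o), derivable (f : R[i]^o -> R[i]^o) w 1.

(* The value of [f] at a pole is irrelevant.  In the last conjunct the order
   and the norm are those of the field [R[i]]. *)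
Definition pole (R : realType) (f : R[i] -> R[i]) (a : R[i]) : Prop :=
  (\forall w \near (a : R[i]^o)^', derivable (f : R[i]^o -> R[i]^o) w 1) /\
  (`|f w| @[w --> (a : R[i]^o)^'] --> +oo).

Definition meromorphic_on (R : realType) (U : set R[i]) (f : R[i] -> R[i]) :
    Prop :=
  forall a, U a -> holomorphic_at f a \/ pole f a.

Definition upper_half (R : realType) : set R[i] :=
  [set z | 0 < complex.Im z].

Definition nonreal (R : realType) : set R[i] :=
  [set z | complex.Im z != 0].

(* Eigenvalues are counted with their algebraic multiplicity.  In a
   [numClosedFieldType], [x < 0] implies that [x] is real. *)
Definition num_neg_eigenvalues (C : numClosedFieldType) (n : nat)
    (A : 'M[C]_n) : nat :=
  count (fun x : C => x < 0) (sval (closed_field_poly_normal (char_poly A))).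

Definition pick_matrix (R : realType) (f : R[i] -> R[i]) (n : nat)
    (z : 'I_n -> R[i]) : 'M[R[i]]_n :=
  \matrix_(k < n, j < n) ((f (z k) - (f (z j))^*) / (z k - (z j)^*)).

Definition admissible (R : realType) (f : R[i] -> R[i]) (n : nat)
    (z : 'I_n -> R[i]) : Prop :=
  (0 < n)%N /\ forall k, upper_half (z k) /\ ~ pole f (z k).

(* The class N_kappa.  Only the restriction of [f] to nonreal arguments
   matters; the second clause says that its values in the lower half-plane are
   given by symmetry. *)
Definition nevanlinna (R : realType) (kappa : nat) (f : R[i] -> R[i]) : Prop :=
  [/\ meromorphic_on (@upper_half R) f,
      forall z, upper_half z -> ~ pole f z -> f z^* = (f z)^*,
      forall n (z : 'I_n -> R[i]), admissible f z ->
        (num_neg_eigenvalues (pick_matrix f z) <= kappa)%N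
    & exists n (z : 'I_n -> R[i]), admissible f z /\
        num_neg_eigenvalues (pick_matrix f z) = kappa].

(* The class N_kappa^lambda. *)
Definition nevanlinna2 (R : realType) (kappa lambda : nat)
    (f : R[i] -> R[i]) : Prop :=
  nevanlinna kappa f /\ nevanlinna lambda (fun z => z * f z).

(* The union of the N_kappa. *)
Definition nevanlinna_fin (R : realType) (f : R[i] -> R[i]) : Prop :=
  exists kappa, nevanlinna kappa f.

(* The union of the N_kappa^lambda. *)
Definition nevanlinna2_fin (R : realType) (f : R[i] -> R[i]) : Prop :=
  exists kappa lambda, nevanlinna2 kappa lambda f.

(* alpha_k / (1 - alpha_(k+1) z / (1 - ... / (1 - alpha_(k+n) z))) *)
Fixpoint cfrac_tail (R : realType) (alpha : nat -> R) (z : R[i]) (k n : nat)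
    {struct n} : R[i] :=
  if n is n'.+1 then
    (alpha k)%:C%C / (1 - z * cfrac_tail alpha z k.+1 n')
  else (alpha k)%:C%C.

(* Used near [z = 0] only, where no denominator of an approximant vanishes and
   the limit exists if [alpha] is bounded. *)
Definition cfrac (R : realType) (alpha : nat -> R) (z : R[i]) : R[i] :=
  lim ((cfrac_tail alpha z 0 n : R[i]^o) @[n --> \oo]).

Definition cfrac_continuation (R : realType) (alpha : nat -> R)
    (f : R[i] -> R[i]) : Prop :=
  meromorphic_on (@nonreal R) f /\
  \forall z \near (0 : R[i]^o), nonreal (z : R[i]) -> f z = cfrac alpha z.

(* [eps] times the continued fraction belongs to the class [P], i.e. it has a
   continuation to the nonreal numbers which belongs to [P]. *)
Definition cfrac_in (R : realType) (alpha : nat -> R) (eps : R)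
    (P : (R[i] -> R[i]) -> Prop) : Prop :=
  exists f, cfrac_continuation alpha f /\ P (fun z => eps%:C%C * f z).

Definition sign_tail (R : realType) (alpha : nat -> R) (m j : nat) : R :=
  Num.sg (\prod_(j <= k < m.*2.+1) alpha k).

(* Main.v *)
Require Import Defs.
From HB Require Import structures.
From mathcomp Require Import all_boot all_order all_algebra.
From mathcomp Require Import complex.
From mathcomp Require Import all_classical all_reals all_analysis.
From mathcomp Require Import ring lra zify.

Set Implicit Arguments.
Unset Strict Implicit.
Unset Printing Implicit Defensive.

Import Order.TTheory GRing.Theory Num.Theory.
Import numFieldNormedType.Exports.

Local Open Scope classical_set_scope.
Local Open Scope ring_scope.

(** Let t_k denote the k-th tail of the continued fraction, so that
    t_k = alpha_k / (1 - z t_(k+1)) and t_0 is the function under study, and let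
    N_f(z, w) = (f(z) - conj f(w)) / (z - conj w) be the Pick kernel of f.
    Everything rests on two identities ([pick_stepK], [pick_stepL]):

      N_(t_k)   = t_k conj(t_k) / alpha_k * N_(z t_(k+1)),
      N_(z t_k) = t_k conj(t_k) / alpha_k * (1 + z conj(w) N_(t_(k+1))).

    Alternating them, one splits off a kernel of rank one at every second step;
    its sign is the sign of a product alpha_0 ... alpha_j.  The function t_0 picks
    up the products with j odd and z t_0 those with j even, which after
    multiplication by the sign eps_0 are the numbers eps_2, eps_4, ... and
    eps_1, eps_3, ....  So the number of negative squares should be the number of
    negative signs ([nneg]).

    Upper bound.  If alpha_k > 0 from some index on, the remaining Pick kernel is
    positive semidefinite: by the two identities this passes from the innermost
    level of an approximant to all of it, and then to the limit.  A form which is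
    positive semidefinite plus a combination of rank one forms, m of them with a
    negative coefficient, has at most m negative eigenvalues ([hkernel_lower],
    [pick_upper]).

    Lower bound.  Near 0 all tails converge and are bounded, whatever the signs.
    A point z_0 tending to 0 along the imaginary axis decouples from the other
    points: the kernel at the enlarged set of points tends to the direct sum of
    the split off square and of the kernel of the next tail.  Hence every negative
    sign contributes one dimension of negativity ([neg_subspaceL]).  This uses
    the values of the function near 0 only, so it applies to any continuation,
    and it also proves the negative statements: if infinitely many products have
    the wrong sign then the number of negative eigenvalues is unbounded.  For
    - eps_0 t_0 this happens because eventually all signs are wrong; if
    infinitely many alpha_n are negative it happens for t_0 or for z t_0, for
    either sign.

    Existence of the continuation.  For positive coefficients the diagonal of the
    identities is an energy balance which bounds the sum of the squares of the
    partial products, hence forces the difference of two approximants of depth at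
    least 2 i to be O(1 / i) at every nonreal point ([tail_cauchy]).  The limit has
    positive semidefinite Pick kernels, also for points in both half-planes, and
    the Cauchy-Schwarz inequality for three points z, z', conj w shows that its
    difference quotients at w are Cauchy, so that it is holomorphic
    ([pick_derivable]).  The function t_0 is then a quotient p / q of functions
    built from a positive tail by finitely many steps, and one has to see that the
    zeros of q are isolated.  At zeros of q the kernel of p / q, multiplied by
    q conj(q), vanishes.  With more zeros than negative squares some nonzero
    combination would be a null vector of the Pick kernel of the positive tail,
    but that kernel is strictly positive at distinct points ([pick_strict]): a null
    vector would be orthogonal to all the rank one terms from some index on; this
    condition is stable under division of the coefficients by the points, so that
    Lagrange interpolation would isolate a single point.  So q has finitely many
    zeros in each half-plane ([den_zeros]). *)

(** * Hermitian forms and negative eigenvalues *)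

Section HermitianForms.
Local Open Scope sesquilinear_scope.
Variable C : numClosedFieldType.

Definition qform n (k : 'I_n -> 'I_n -> C) (x : 'I_n -> C) : C :=
  \sum_i \sum_j x i * (x j)^* * k i j.

Lemma exists_common_kernel (n : nat) (K : finType) (F : K -> 'I_n -> C) :
  (#|K| < n)%N ->
  exists x : 'I_n -> C, (exists i, x i != 0) /\
    forall k, \sum_i x i * F k i = 0.
Proof.
move=> Kn.
pose M : 'M[C]_(n, #|K|) := \matrix_(i, a) F (enum_val a) i.
have kN0 : kermx M != 0.
  rewrite kermx_eq0 /row_free neq_ltn; apply/orP; left.
  exact: leq_ltn_trans (rank_leq_col M) Kn.
exists (nz_row (kermx M) 0); split.
  have /eqP/rowP nz : nz_row (kermx M) != 0 by rewrite nz_row_eq0.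
  apply: contrapT => H; apply: nz => i; rewrite mxE.
  by apply/eqP/negPn/negP => Hi; apply: H; exists i.
move=> k.
have /sub_kermxP /matrixP/(_ 0 (enum_rank k)) := nz_row_sub (kermx M).
rewrite !mxE => E; rewrite -[RHS]E; apply: eq_bigr => i _.
by rewrite !mxE enum_rankK.
Qed.

Lemma spectral_qform n (A : 'M[C]_n) : A \is hermsymmx ->
  exists (d : 'I_n -> C) (U : 'M[C]_n),
  [/\ U \in unitmx, forall l, d l \is Num.real,
      num_neg_eigenvalues A = #|[pred l | d l < 0]|
    & forall x : 'I_n -> C,
      qform A x = \sum_l d l * `|\sum_i x i * U i l| ^+ 2].
Proof.
move=> hA; set P := spectralmx A; set D := spectral_diag A.
have uP : P \is unitarymx by exact: spectral_unitarymx.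
have iP : invmx P = P^t* by exact: invmx_unitary.
have PU : P \in unitmx by exact: spectral_unit.
have eA : A = invmx P *m diag_mx D *m P.
  exact/orthomx_spectralP/hermitian_normalmx.
have rD := hermitian_spectral_diag_real hA.
exists (fun l => D 0 l), (invmx P); split.
- by rewrite unitmx_inv.
- by move=> l; apply: (mxOverP rD).
- have cp : char_poly A = \prod_i ('X - (D 0 i)%:P).
    rewrite -[RHS](_ : char_poly (diag_mx D) = _); last first.
      rewrite char_poly_trig ?diag_mx_is_trig//.
      by apply: eq_bigr => i _; rewrite mxE eqxx.
    rewrite /char_poly /char_poly_mx eA.
    have -> : 'X%:M - map_mx (@polyC C) (invmx P *m diag_mx D *m P) =
      map_mx (@polyC C) (invmx P) *m ('X%:M - map_mx (@polyC C) (diag_mx D)) *m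
      map_mx (@polyC C) P.
      rewrite mulmxBr mulmxBl -!map_mxM; congr (_ - _).
      by rewrite scalar_mxC -mulmxA -map_mxM mulVmx// map_mx1 mulmx1.
    by rewrite !det_mulmx mulrAC -det_mulmx -map_mxM mulVmx// map_mx1 det1 mul1r.
  rewrite /num_neg_eigenvalues; case: closed_field_poly_normal => r /= Er.
  move: Er; rewrite (eqP (char_poly_monic _)) scale1r cp => Er.
  have /prod_XsubC_eq /permP -> : \prod_(z <- r) ('X - z%:P) =
      \prod_(z <- [seq D 0 i | i <- enum 'I_n]) ('X - z%:P).
    by rewrite -Er big_map big_enum.
  by rewrite count_map cardE -size_filter enumT.
move=> x; rewrite /qform.
have eAij i j : A i j = \sum_l (invmx P) i l * D 0 l * ((invmx P) j l)^*.
  rewrite {1}eA mxE; apply: eq_bigr => l _.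
  rewrite mul_mx_diag !mxE iP !mxE conjCK; congr (_ * _).
transitivity (\sum_i \sum_j \sum_l
    D 0 l * (x i * invmx P i l) * ((x j)^* * (invmx P j l)^* )).
  apply: eq_bigr => i _; apply: eq_bigr => j _; rewrite eAij mulr_sumr.
  by apply: eq_bigr => l _; ring.
rewrite (eq_bigr (fun i => \sum_l \sum_j
    D 0 l * (x i * invmx P i l) * ((x j)^* * (invmx P j l)^* ))); last first.
  by move=> i _; rewrite exchange_big.
rewrite exchange_big; apply: eq_bigr => l _ /=.
rewrite normCK rmorph_sum /= mulrA [D 0 l * _]mulr_sumr mulr_suml.
apply: eq_bigr => i _; rewrite mulr_sumr; apply: eq_bigr => j _.
by rewrite rmorphM.
Qed.

(** With more than [m] negative eigenvalues, the span of their eigenvectors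
    would contain a nonzero vector annihilated by the [m] functionals [V]. *)
Lemma num_neg_le n (A : 'M[C]_n) m (V : 'I_m -> 'I_n -> C) : A \is hermsymmx ->
  (forall x : 'I_n -> C, (forall l, \sum_i x i * V l i = 0) -> 0 <= qform A x) ->
  (num_neg_eigenvalues A <= m)%N.
Proof.
move=> /spectral_qform[d [U [Uu rd -> Q]]] HV; rewrite leqNgt; apply/negP => lt.
(* The vector sought is killed by V and by the coordinates with a nonnegative
   eigenvalue. *)
pose K := ({l : 'I_n | ~~ (d l < 0)} + 'I_m)%type.
pose F (k : K) i := match k with inl l => U i (val l) | inr l => V l i end.
have [|x [[i0 xi0] xF]] := @exists_common_kernel n K F.
  rewrite card_sum card_sig card_ord.
  rewrite -[X in (_ < X)%N]card_ord -(cardC [pred l | d l < 0]) addnC.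
  rewrite ltn_add2r; exact: lt.
have x0 l : ~~ (d l < 0) -> \sum_i x i * U i l = 0.
  by move=> dl; have := xF (inl (exist _ l dl)).
have := HV x (fun l => xF (inr l)); rewrite Q => Q0.
have le0 l : true -> d l * `|\sum_i x i * U i l| ^+ 2 <= 0.
  move=> _; case: (boolP (d l < 0)) => [dl|/x0->].
    by rewrite mulr_le0_ge0 ?(ltW dl)// exprn_ge0.
  by rewrite normr0 expr0n mulr0.
have : - \sum_l d l * `|\sum_i x i * U i l| ^+ 2 == 0.
  by rewrite oppr_eq0 eq_le Q0 andbT sumr_le0.
rewrite -sumrN psumr_eq0; last by move=> l _; rewrite oppr_ge0 le0.
move=> /allP /= H.
have xU : (\row_i x i) *m U = 0.
  apply/rowP => l; rewrite !mxE.
  under eq_bigr do rewrite mxE.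
  case: (boolP (d l < 0)) => [dl|/x0//].
  have := H l (mem_index_enum _).
  rewrite oppr_eq0 mulf_eq0 (lt_eqF dl) /= expf_eq0 /= normr_eq0.
  by move/eqP.
move: xi0; have := congr1 (mulmx^~ (invmx U)) xU.
rewrite mulmxK// mul0mx => /rowP/(_ i0); rewrite !mxE => ->.
by rewrite eqxx.
Qed.

(** Otherwise some nonzero vector of the negative subspace spanned by [B]
    would be orthogonal to all eigenvectors with a negative eigenvalue. *)
Lemma num_neg_ge n (A : 'M[C]_n) r (B : 'I_r -> 'I_n -> C) : A \is hermsymmx ->
  (forall y : 'I_r -> C, (exists l, y l != 0) ->
    qform A (fun i => \sum_l y l * B l i) < 0) ->
  (r <= num_neg_eigenvalues A)%N.
Proof.
move=> /spectral_qform[d [U [Uu rd -> Q]]] HB; rewrite leqNgt; apply/negP => lt.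
pose K := {l : 'I_n | d l < 0}.
pose F (k : K) (l : 'I_r) := \sum_i B l i * U i (val k).
have [|y [y0 yF]] := @exists_common_kernel r K F; first by rewrite card_sig.
have := HB y y0; rewrite Q => /lt_geF; rewrite sumr_ge0// => l _.
have [dl|] := real_ltP (rd l) (real0 _); last first.
  by move=> dl; rewrite mulr_ge0// exprn_ge0.
have := yF (exist _ l dl); rewrite /F /= => yFl.
rewrite [\sum_i _](_ : _ = 0) ?normr0 ?expr0n ?mulr0//.
rewrite -[RHS]yFl [RHS](eq_bigr (fun a => \sum_i y a * B a i * U i l)); last first.
  by move=> a _; rewrite mulr_sumr; apply: eq_bigr => i _; rewrite mulrA.
rewrite [RHS]exchange_big /=; apply: eq_bigr => i _.
by rewrite mulr_suml.
Qed.

End HermitianForms.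

Section QformTheory.
Variable C : numClosedFieldType.

Lemma eq_qform n (k k' : 'I_n -> 'I_n -> C) x :
  (forall i j, k i j = k' i j) -> qform k x = qform k' x.
Proof. by move=> e; apply: eq_bigr => i _; apply: eq_bigr => j _; rewrite e. Qed.

Lemma qform_ext n (k : 'I_n -> 'I_n -> C) x y : x =1 y -> qform k x = qform k y.
Proof. by move=> e; apply: eq_bigr => i _; apply: eq_bigr => j _; rewrite !e. Qed.

Lemma qformZ n c (k : 'I_n -> 'I_n -> C) x :
  qform (fun i j => c * k i j) x = c * qform k x.
Proof.
rewrite /qform mulr_sumr; apply: eq_bigr => i _; rewrite mulr_sumr.
by apply: eq_bigr => j _; rewrite mulrCA.
Qed.

Lemma qformD n (k k' : 'I_n -> 'I_n -> C) x :
  qform (fun i j => k i j + k' i j) x = qform k x + qform k' x.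
Proof.
rewrite /qform -big_split; apply: eq_bigr => i _ /=; rewrite -big_split.
by apply: eq_bigr => j _; rewrite /= mulrDr.
Qed.

Lemma qform_rank1 n (u x : 'I_n -> C) :
  qform (fun i j => u i * (u j)^*) x = `|\sum_i x i * u i| ^+ 2.
Proof.
rewrite normCK rmorph_sum mulr_suml; apply: eq_bigr => i _ /=.
rewrite mulr_sumr; apply: eq_bigr => j _; rewrite rmorphM /=; ring.
Qed.

Lemma qform_congr n (g : 'I_n -> C) k x :
  qform (fun i j => g i * (g j)^* * k i j) x = qform k (fun i => x i * g i).
Proof.
apply: eq_bigr => i _; apply: eq_bigr => j _; rewrite rmorphM /=; ring.
Qed.

Definition psd n (k : 'I_n -> 'I_n -> C) := forall x, 0 <= qform k x.

Lemma sum_delta n (F : 'I_n -> C) i0 : \sum_i (i == i0)%:R * F i = F i0.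
Proof.
rewrite (bigD1 i0) //= eqxx mul1r big1 ?addr0// => i /negbTE ->.
by rewrite mul0r.
Qed.

Lemma qform_delta n (k : 'I_n -> 'I_n -> C) i0 :
  qform k (fun i => (i == i0)%:R) = k i0 i0.
Proof.
rewrite /qform.
under eq_bigr => i _ do under eq_bigr => j _ do rewrite conjC_nat -mulrA.
under eq_bigr => i _ do rewrite -mulr_sumr sum_delta.
exact: sum_delta.
Qed.

Lemma psd_diag n (k : 'I_n -> 'I_n -> C) i : psd k -> 0 <= k i i.
Proof. by move=> /(_ (fun j => (j == i)%:R)); rewrite qform_delta. Qed.

(** The Cauchy-Schwarz inequality of a positive semidefinite form, written
    for the 2 x 2 matrix with entries [p], [b], [b^*], [q]. *)
Lemma psd2_le (p q b : C) : 0 <= p -> 0 <= q ->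
  (forall s t : C, 0 <= s * s^* * p + s * t^* * b + s^* * t * b^* + t * t^* * q) ->
  b * b^* <= p * q.
Proof.
move=> p0 q0 H.
have pr : p^* = p by apply: conj_Creal; rewrite realE p0.
have qr : q^* = q by apply: conj_Creal; rewrite realE q0.
have [q_gt0|] := boolP (0 < q).
  have := H q (- b); rewrite rmorphN /= qr.
  rewrite [X in 0 <= X -> _](_ : _ = q * (p * q - b * b^*)); last by ring.
  by rewrite pmulr_rge0// subr_ge0.
rewrite lt_neqAle q0 andbT negbK eq_sym => /eqP q_eq0.
have [p_gt0|] := boolP (0 < p).
  have := H (- b^*) p; rewrite rmorphN /= conjCK pr.
  rewrite [X in 0 <= X -> _](_ : _ = p * (p * q - b * b^*)); last by ring.
  by rewrite pmulr_rge0// subr_ge0.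
rewrite lt_neqAle p0 andbT negbK eq_sym => /eqP p_eq0.
(* Now p = q = 0, and the form would take the value - 2 |b|^2. *)
have := H 1 (- b); rewrite rmorphN rmorph1 p_eq0 q_eq0.
rewrite [X in 0 <= X -> _](_ : _ = (p * q - b * b^*) *+ 2); last first.
  by rewrite p_eq0 q_eq0; ring.
by rewrite pmulrn_lge0// subr_ge0 p_eq0 q_eq0.
Qed.

End QformTheory.

(** * One step of the continued fraction *)

Section PickStep.
Variable C : numClosedFieldType.

(** The relation says [- a / f = z g - 1].  Real constants do not change the
    Pick kernel, and [f |-> - 1 / f] divides it by [f(z)] and by the conjugate of
    [f(w)]. *)
Lemma pick_stepK (a z w fz fw gz gw : C) : a != 0 -> a \is Num.real ->
  fz * (1 - z * gz) = a -> fw * (1 - w * gw) = a ->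
  (fz - fw^*) / (z - w^*) =
  a * (fz / a * (fw / a)^* * ((z * gz - (w * gw)^*) / (z - w^*))).
Proof.
move=> a0 ar ez ew; have ac := conj_Creal ar.
have ewc : fw^* * (1 - w^* * gw^*) = a.
  by rewrite -[RHS]ac -ew !(rmorphM, rmorphB, rmorph1).
have -> : fz - fw^* = fz * fw^* * (z * gz - w^* * gw^*) / a.
  have <- : fz * (fw^* * (1 - w^* * gw^*)) - fw^* * (fz * (1 - z * gz)) =
     fz * fw^* * (z * gz - w^* * gw^*) by ring.
  by rewrite ewc ez; field.
rewrite !(rmorphM, fmorphV) /= ac.
set X := (z - _)^-1; set F := fw^*; set G := gw^*; set W := w^*.
by field.
Qed.

(** Here [- a / (z f)] is [g - 1 / z], and the Pick kernel of [- 1 / z] is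
    the rank one kernel with entries [z^-1] times the conjugate of [w^-1]. *)
Lemma pick_stepL (a z w fz fw gz gw : C) : a != 0 -> a \is Num.real ->
  z - w^* != 0 ->
  fz * (1 - z * gz) = a -> fw * (1 - w * gw) = a ->
  (z * fz - (w * fw)^*) / (z - w^*) =
  a * (fz / a * (fw / a)^* * (1 + z * w^* * ((gz - gw^*) / (z - w^*)))).
Proof.
move=> a0 ar zw ez ew; have ac := conj_Creal ar.
have ewc : fw^* * (1 - w^* * gw^*) = a.
  by rewrite -[RHS]ac -ew !(rmorphM, rmorphB, rmorph1).
have E : z * fz - w^* * fw^* =
    fz * fw^* * ((z - w^*) + z * w^* * (gz - gw^*)) / a.
  have <- : z * fz * (fw^* * (1 - w^* * gw^*)) - w^* * fw^* * (fz * (1 - z * gz)) =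
     fz * fw^* * ((z - w^*) + z * w^* * (gz - gw^*)) by ring.
  by rewrite ewc ez; field.
rewrite [(w * fw)^*]rmorphM /= E !(rmorphM, fmorphV) /= ac.
move: zw; set F := fw^*; set G := gw^*; set W := w^* => zw.
by field; rewrite a0 zw.
Qed.

(** A zero would give [g = 1 / z], whose Pick kernel on the diagonal is
    [- 1 / |z|^2]. *)
Lemma tail_denom_neq0 (z g : C) : z - z^* != 0 ->
  0 <= (g - g^*) / (z - z^*) -> 1 - z * g != 0.
Proof.
move=> zz; apply: contraTneq => /eqP; rewrite subr_eq0 => /eqP e.
have z0 : z != 0 by apply: contraNneq zz => ->; rewrite conjC0 subr0.
have zc0 : z^* != 0 by rewrite conjC_eq0.
have -> : g = z^-1 by apply: (mulfI z0); rewrite -e mulfV.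
rewrite fmorphV /=.
rewrite [X in 0 <= X](_ : _ = - (z * z^*)^-1); last first.
  move: zz zc0; set Z := z^* => zz zc0; by field; rewrite zz zc0 z0.
apply/negP; rewrite oppr_ge0 => /le_gtF.
by rewrite invr_gt0 lt_neqAle mul_conjC_ge0 eq_sym mulf_neq0.
Qed.

Lemma pick_herm (f g z w : C) :
  ((f - g^*) / (z - w^*))^* = (g - f^*) / (w - z^*).
Proof.
by rewrite fmorph_div !rmorphB /= !conjCK -opprB -[z^* - w]opprB invrN mulrNN.
Qed.

End PickStep.

(** A function enters only through its values [f i] at the points [z i]. *)
Definition pick_kernel (C : numClosedFieldType) n (z f : 'I_n -> C) i j : C :=
  (f i - (f j)^*) / (z i - (z j)^*).

Section PickSteps.
Variables (C : numClosedFieldType) (n : nat) (z : 'I_n -> C) (a : C).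
Variables f g : 'I_n -> C.
Hypothesis zz : forall i j, z i - (z j)^* != 0.
Hypothesis a0 : a != 0.
Hypothesis ar : a \is Num.real.
Hypothesis fg : forall i, f i * (1 - z i * g i) = a.

Lemma qform_pickK x : qform (pick_kernel z f) x =
  a * qform (pick_kernel z (fun i => z i * g i)) (fun i => x i * (f i / a)).
Proof.
rewrite -qform_congr -qformZ; apply: eq_qform => i j.
exact: (pick_stepK a0 ar (fg i) (fg j)).
Qed.

Lemma qform_pickL x : qform (pick_kernel z (fun i => z i * f i)) x =
  a * (`|\sum_i x i * (f i / a)| ^+ 2 +
       qform (pick_kernel z g) (fun i => x i * (f i / a) * z i)).
Proof.
rewrite -qform_rank1 -qform_congr -qform_congr -qformD -qformZ.
apply: eq_qform => i j; rewrite /pick_kernel (pick_stepL a0 ar (zz i j) (fg i) (fg j)).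
by rewrite mulrDr mulr1 !mulrA.
Qed.

Lemma psd_pickK : 0 < a -> psd (pick_kernel z (fun i => z i * g i)) ->
  psd (pick_kernel z f).
Proof. by move=> a_gt0 H x; rewrite qform_pickK mulr_ge0// ltW. Qed.

Lemma psd_pickL : 0 < a -> psd (pick_kernel z g) ->
  psd (pick_kernel z (fun i => z i * f i)).
Proof.
by move=> a_gt0 H x; rewrite qform_pickL mulr_ge0 ?(ltW a_gt0)// addr_ge0 ?exprn_ge0.
Qed.

End PickSteps.

Section Energy.
Variable C : numClosedFieldType.
Implicit Types (a b z f g h : C).

Lemma energyK a z f g : a != 0 -> a \is Num.real ->
  f * (1 - z * g) = a ->
  (f - f^*) / (z - z^*) =
  `|f| ^+ 2 / a * ((z * g - (z * g)^*) / (z - z^*)).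
Proof.
move=> a0 ar fg; rewrite (pick_stepK a0 ar fg fg) normCK !(rmorphM, fmorphV) /=.
by rewrite (conj_Creal ar) !mulrA; congr (_ * _ * _); field.
Qed.

Lemma energyL a z f g : a != 0 -> a \is Num.real -> z - z^* != 0 ->
  f * (1 - z * g) = a ->
  (z * f - (z * f)^*) / (z - z^*) =
  `|f| ^+ 2 / a * (1 + `|z| ^+ 2 * ((g - g^*) / (z - z^*))).
Proof.
move=> a0 ar zz fg; rewrite (pick_stepL a0 ar zz fg fg) !normCK.
rewrite !(rmorphM, fmorphV) /= (conj_Creal ar) !mulrA; congr (_ * _).
by field.
Qed.

(** The energy identity bounds [|f|^2 / a] by the Pick kernel of [z f] on the
    diagonal, which is linear in [|f|]. *)
Lemma tail_bound a z f g A : 0 < a -> a <= A -> z - z^* != 0 ->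
  f * (1 - z * g) = a -> 0 <= (g - g^*) / (z - z^*) ->
  `|f| <= A * (2 * `|z| / `|z - z^*|).
Proof.
move=> a0 aA zz fg g0; have a_neq0 := lt0r_neq0 a0.
have f0 : 0 < `|f|.
  rewrite normr_gt0; apply: contraTneq a_neq0 => f0.
  by rewrite -fg f0 mul0r eqxx.
have H : `|f| ^+ 2 / a <= (z * f - (z * f)^*) / (z - z^*).
  rewrite (energyL a_neq0 (gtr0_real a0) zz fg) ler_peMr//.
    by rewrite divr_ge0 ?exprn_ge0// (ltW a0).
  by rewrite lerDl mulr_ge0 ?exprn_ge0.
have H2 : (z * f - (z * f)^*) / (z - z^*) <= 2 * `|z| / `|z - z^*| * `|f|.
  apply: le_trans (real_ler_norm _) _.
    by rewrite ger0_real// (le_trans _ H)// divr_ge0 ?exprn_ge0// (ltW a0).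
  rewrite normrM normfV mulrAC ler_pM2r ?invr_gt0 ?normr_gt0//.
  apply: le_trans (ler_normB _ _) _; rewrite norm_conjC normrM.
  by rewrite -mulr2n -mulrA mulr_natl.
move: (le_trans H H2); rewrite expr2 -mulrA [_ * `|f|]mulrC ler_pM2l//.
rewrite ler_pdivrMr// => /le_trans; apply.
by rewrite mulrC ler_wpM2r// divr_ge0 ?normr_ge0// mulr_ge0 ?normr_ge0 ?ler0n.
Qed.

Lemma tail_sub a z f g f' g' : a != 0 -> f * (1 - z * g) = a ->
  f' * (1 - z * g') = a -> f - f' = f * f' / a * (z * g - z * g').
Proof.
move=> a0 e e'.
have <- : f * (f' * (1 - z * g')) / a - f' * (f * (1 - z * g)) / a =
  f * f' / a * (z * g - z * g') by ring.
by rewrite e e'; field.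
Qed.

End Energy.

(** * Limits and derivatives over the complex numbers *)

Section ComplexNumbers.
Variable R : realType.
Local Notation C := (R[i]).

Lemma ge0_complex (c : C) : 0 <= c -> exists2 r : R, 0 <= r & c = r%:C%C.
Proof.
case: c => a b; rewrite lecE /= => /andP[/eqP -> a0]; by exists a.
Qed.

Lemma gt0_complex (c : C) : 0 < c -> exists2 r : R, 0 < r & c = r%:C%C.
Proof.
case: c => a b; rewrite ltcE /= => /andP[/eqP -> a0]; by exists a.
Qed.

Lemma norm_le_ReIm (z : C) : `|z| <= (`|complex.Re z| + `|complex.Im z|)%:C%C.
Proof.
rewrite {1}[z]complexE; apply: le_trans (ler_normD _ _) _.
rewrite normrM; have -> : `|'i%C| = 1 :> C.
  by rewrite normc_def /= expr0n expr1n add0r sqrtr1.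
rewrite mul1r !normc_def /= !expr0n /= !addr0 !sqrtr_sqr.
by rewrite -rmorphD.
Qed.

Lemma Im_le_norm (z : C) : `|complex.Im z|%:C%C <= `|z|.
Proof.
have := normc_ge_Re (z * 'i%C); rewrite ReiNIm normrN normrM.
have -> : `|'i%C| = 1 :> C.
  by rewrite normc_def /= expr0n expr1n add0r sqrtr1.
by rewrite mulr1.
Qed.

Lemma conj_realC (x : R) : (x%:C%C : C)^* = x%:C%C.
Proof. exact: conjc_real. Qed.

Lemma realC_real (x : R) : (x%:C%C : C) \is Num.real.
Proof. by apply/complex_realP; exists x. Qed.

Lemma realC_neq0 (x : R) : x != 0 -> x%:C%C != 0 :> C.
Proof. by move=> x0; rewrite eq_complex /= negb_and x0. Qed.

Lemma realC_gt0 (x : R) : (0 < x%:C%C :> C) = (0 < x).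
Proof. by rewrite -ltcR. Qed.

Lemma Im_sub_conj (z w : C) :
  complex.Im (z - w^*) = complex.Im z + complex.Im w.
Proof. by case: z w => a b [c d] /=; rewrite opprK. Qed.

Lemma sub_conj_neq0 (z : C) : (z - z^* != 0) = (complex.Im z != 0).
Proof.
case: z => a b; rewrite eq_complex /= subrr eqxx /= opprK.
by rewrite -mulr2n mulrn_eq0.
Qed.

Lemma upper_sub_conj (z w : C) : upper_half z -> upper_half w -> z - w^* != 0.
Proof.
move=> z0 w0; apply/eqP => /(congr1 (@complex.Im R)); rewrite Im_sub_conj /=.
by apply/eqP; rewrite gt_eqF// addr_gt0.
Qed.

Lemma upper_nonreal (z : C) : upper_half z -> nonreal z.
Proof. by move=> z0; rewrite /nonreal /= gt_eqF. Qed.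

End ComplexNumbers.

(* The rules are stated over an abstract field first because the structures of
   the regular module over the complex numbers are large terms. *)
Section RegularRules.
Variable K : numFieldType.

Section Limits.
Variables (T : Type) (F : set_system T).
Context {FF : Filter F}.
Implicit Types (f g : T -> K^o) (a b : K^o).

Lemma regular_cvgM f g a b : f @ F --> a -> g @ F --> b ->
  (fun x => (f x : K) * g x : K^o) @ F --> ((a : K) * b : K^o).
Proof. exact: cvgM. Qed.

Lemma regular_cvgB f g a b : f @ F --> a -> g @ F --> b ->
  (fun x => (f x : K) - g x : K^o) @ F --> ((a : K) - b : K^o).
Proof. exact: cvgB. Qed.

Lemma regular_cvgD f g a b : f @ F --> a -> g @ F --> b ->
  (fun x => (f x : K) + g x : K^o) @ F --> ((a : K) + b : K^o).
Proof. exact: cvgD. Qed.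

Lemma regular_cvgV f a : a != 0 -> f @ F --> a ->
  (fun x => (f x : K)^-1 : K^o) @ F --> ((a : K)^-1 : K^o).
Proof. exact: cvgV. Qed.

End Limits.

Implicit Types (f g : K^o -> K^o) (x v : K^o).

Lemma regular_derivableM f g x v : derivable f x v -> derivable g x v ->
  derivable (fun y => (f y : K) * g y : K^o) x v.
Proof. exact: derivableM. Qed.

Lemma regular_derivableV f x v : f x != 0 -> derivable f x v ->
  derivable (fun y => (f y : K)^-1 : K^o) x v.
Proof. exact: derivableV. Qed.

Lemma regular_derivableB f g x v : derivable f x v -> derivable g x v ->
  derivable (fun y => (f y : K) - g y : K^o) x v.
Proof. exact: derivableB. Qed.

Lemma regular_derivable_cst (a : K) x v : derivable ((fun=> a) : K^o -> K^o) x v.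
Proof. exact: derivable_cst. Qed.

Lemma regular_derivable_id x v : derivable (id : K^o -> K^o) x v.
Proof. exact: derivable_id. Qed.

Lemma regular_derivable_continuous f x : derivable f x 1 -> {for x, continuous f}.
Proof. by move/derivable1_diffP/differentiable_continuous. Qed.

End RegularRules.

Section ComplexRules.
Variable R : realType.
Local Notation C := (R[i]).

Section Limits.
Variables (T : Type) (F : set_system T).
Context {FF : Filter F}.
Implicit Types (f g : T -> C) (a b : C).

Lemma ccvgM f g a b : (f : T -> R[i]^o) @ F --> (a : R[i]^o) ->
  (g : T -> R[i]^o) @ F --> (b : R[i]^o) ->
  (fun x => f x * g x : R[i]^o) @ F --> (a * b : R[i]^o).
Proof. exact: (@regular_cvgM C). Qed.

Lemma ccvgB f g a b : (f : T -> R[i]^o) @ F --> (a : R[i]^o) ->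
  (g : T -> R[i]^o) @ F --> (b : R[i]^o) ->
  (fun x => f x - g x : R[i]^o) @ F --> (a - b : R[i]^o).
Proof. exact: (@regular_cvgB C). Qed.

Lemma ccvgD f g a b : (f : T -> R[i]^o) @ F --> (a : R[i]^o) ->
  (g : T -> R[i]^o) @ F --> (b : R[i]^o) ->
  (fun x => f x + g x : R[i]^o) @ F --> (a + b : R[i]^o).
Proof. exact: (@regular_cvgD C). Qed.

Lemma ccvg_eq f a b : (f : T -> R[i]^o) @ F --> (a : R[i]^o) -> a = b ->
  (f : T -> R[i]^o) @ F --> (b : R[i]^o).
Proof. by move=> H <-. Qed.

Lemma ccvgV f a : a != 0 -> (f : T -> R[i]^o) @ F --> (a : R[i]^o) ->
  (fun x => (f x)^-1 : R[i]^o) @ F --> (a^-1 : R[i]^o).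
Proof. exact: (@regular_cvgV C). Qed.

Lemma ccvg_cst a : (fun=> a : R[i]^o) @ F --> (a : R[i]^o).
Proof. exact: cvg_cst. Qed.

Lemma ccvg_conj f a : (f : T -> R[i]^o) @ F --> (a : R[i]^o) ->
  (fun x => (f x)^* : R[i]^o) @ F --> (a^* : R[i]^o).
Proof.
move=> /cvgrPdist_lt H; apply/cvgrPdist_lt => e e0.
by apply: filterS (H e e0) => x; rewrite -rmorphB norm_conjC.
Qed.

Lemma ccvg_near f a (e : C) : (f : T -> R[i]^o) @ F --> (a : R[i]^o) -> 0 < e ->
  \forall x \near F, `|a - f x| < e.
Proof. by move=> /cvgrPdist_lt H e0; exact: H. Qed.

Lemma ccvg_neq0 f a : a != 0 -> (f : T -> R[i]^o) @ F --> (a : R[i]^o) ->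
  \forall x \near F, f x != 0.
Proof.
move=> a0 fa; have na : 0 < `|a| by rewrite normr_gt0.
apply: filterS (ccvg_near fa na) => x; apply: contraTneq => ->.
by rewrite subr0 ltxx.
Qed.

Lemma ccvg_bounded f a : (f : T -> R[i]^o) @ F --> (a : R[i]^o) ->
  \forall x \near F, `|f x| <= `|a| + 1.
Proof.
move=> fa; apply: filterS (ccvg_near fa ltr01) => x ax.
rewrite -lerBlDl; apply: le_trans (ltW ax).
by rewrite distrC lerB_dist.
Qed.

End Limits.

Lemma ccvg_unique (T : Type) (F : set_system T) (PF : ProperFilter F)
    (f : T -> C) (a b : C) : (f : T -> R[i]^o) @ F --> (a : R[i]^o) ->
  (f : T -> R[i]^o) @ F --> (b : R[i]^o) -> a = b.
Proof. by apply: cvg_unique. Qed.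

(** The complex numbers inherit completeness from their real and imaginary
    parts. *)
Lemma cauchy_complex_cvg (T : Type) (F : set_system T) (u : T -> C) :
  ProperFilter F ->
  (forall e : R, 0 < e -> exists2 A, F A &
     forall x y, A x -> A y -> `|u x - u y| < e%:C%C) ->
  cvg ((u : T -> R[i]^o) @ F).
Proof.
move=> PF H.
have cv (v : T -> R) : (forall n m, `|v n - v m|%:C%C <= `|u n - u m|) ->
    cvg (v @ F).
  move=> Hv; apply/cauchy_cvgP/cauchyP => e /H[A FA HA].
  have [x0 Ax0] := filter_ex FA.
  exists (v x0); suff : F (v @^-1` (ball (v x0) e)) by [].
  apply: filterS FA => x Ax; rewrite /ball /=.
  suff : `|v x0 - v x|%:C%C < e%:C%C by rewrite ltcR.
  by apply: le_lt_trans (Hv _ _) _; exact: HA.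
have cR : cvg ((fun n => complex.Re (u n)) @ F).
  by apply: cv => n m; rewrite -raddfB; apply: normc_ge_Re.
have cI : cvg ((fun n => complex.Im (u n)) @ F).
  by apply: cv => n m; rewrite -raddfB; apply: Im_le_norm.
apply/cvg_ex; exists (Complex (lim ((fun n => complex.Re (u n)) @ F))
   (lim ((fun n => complex.Im (u n)) @ F))).
apply/cvgrPdist_lt => e /gt0_complex[r r0 ->].
have r2 : 0 < r / 2 by rewrite divr_gt0.
near=> n; apply: le_lt_trans (norm_le_ReIm _) _; rewrite ltcR.
rewrite [r]splitr; apply: ltrD.
  rewrite raddfB /=; near: n.
  by move/cvgrPdist_lt : cR => /(_ _ r2).
rewrite raddfB /=; near: n.
by move/cvgrPdist_lt : cI => /(_ _ r2).
Unshelve. all: by end_near.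
Qed.

Lemma ccvg_id (a : C) : (fun z : C => z : R[i]^o) @ (a : R[i]^o) --> (a : R[i]^o).
Proof. exact: cvg_id. Qed.

Lemma dnbhs_nbhs (a : C) (P : set C) : (\forall z \near (a : R[i]^o), P z) ->
  \forall z \near (a : R[i]^o)^', P z.
Proof. exact: (@cvg_within _ (nbhs (a : R[i]^o))). Qed.

Lemma cvgn_harmonic (u : nat -> C) (M : R) :
  (forall i n m, (i.*2 <= n)%N -> (i.*2 <= m)%N ->
     i%:R * `|u n - u m| <= M%:C%C) ->
  cvgn (u : nat -> R[i]^o).
Proof.
move=> H; apply: cauchy_complex_cvg => e e0.
pose i := (Num.truncn (M / e)).+1.
exists [set n | (i.*2 <= n)%N]; first by exists i.*2.
move=> n m /= ni mi; rewrite -(ltr_pM2l (ltr0n _ i : 0 < i%:R)).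
apply: le_lt_trans (H i n m ni mi) _.
rewrite -(rmorph_nat (real_complex R)) -rmorphM ltcR -ltr_pdivrMr//.
exact: truncnS_gt.
Qed.

Lemma le_lim_ge0 (u : nat -> C) (l : C) :
  (u : nat -> R[i]^o) @ \oo --> (l : R[i]^o) -> (forall n, 0 <= u n) -> 0 <= l.
Proof.
move=> ul u0; rewrite lecE /=.
have near e : 0 < e -> exists n, `|l - u n| < e%:C%C.
  move=> e0; have e0C : 0 < e%:C%C :> C by rewrite ltcR.
  move/cvgrPdist_lt : ul => /(_ _ e0C)[N _ /(_ N (leqnn N))].
  by exists N.
apply/andP; split.
  apply/negPn/negP; rewrite -normr_gt0 => /near[n].
  have := ger0_Im (u0 n) => un.
  have := Im_le_norm (l - u n); rewrite raddfB /= un subr0.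
  by move=> /le_lt_trans h /h; rewrite ltxx.
rewrite leNgt; apply/negP => /= l0.
have /near[n] : 0 < - complex.Re l by rewrite oppr_gt0.
have := normc_ge_Re (l - u n) => /le_lt_trans h /h.
rewrite ltcR raddfB /=.
have un : 0 <= complex.Re (u n) by have := u0 n; rewrite lecE /= => /andP[].
rewrite ltr0_norm; last by lra.
by move=> ?; lra.
Qed.

Lemma cderivable_cvg (f : C -> C) (a : C) :
  derivable (f : R[i]^o -> R[i]^o) a 1 ->
  (f : C -> R[i]^o) @ (a : R[i]^o) --> (f a : R[i]^o).
Proof. exact: (@regular_derivable_continuous C). Qed.

Lemma cderivableM (f g : C -> C) (a : C) :
  derivable (f : R[i]^o -> R[i]^o) a 1 -> derivable (g : R[i]^o -> R[i]^o) a 1 ->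
  derivable ((fun z => f z * g z) : R[i]^o -> R[i]^o) a 1.
Proof. exact: (@regular_derivableM C). Qed.

Lemma cderivableB (f g : C -> C) (a : C) :
  derivable (f : R[i]^o -> R[i]^o) a 1 -> derivable (g : R[i]^o -> R[i]^o) a 1 ->
  derivable ((fun z => f z - g z) : R[i]^o -> R[i]^o) a 1.
Proof. exact: (@regular_derivableB C). Qed.

Lemma cderivableV (f : C -> C) (a : C) : f a != 0 ->
  derivable (f : R[i]^o -> R[i]^o) a 1 ->
  derivable ((fun z => (f z)^-1) : R[i]^o -> R[i]^o) a 1.
Proof. exact: (@regular_derivableV C). Qed.

Lemma cderivable_cst (c a : C) : derivable ((fun=> c) : R[i]^o -> R[i]^o) a 1.
Proof. exact: (@regular_derivable_cst C). Qed.

Lemma cderivable_id (a : C) : derivable ((fun z => z) : R[i]^o -> R[i]^o) a 1.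
Proof. exact: (@regular_derivable_id C). Qed.

End ComplexRules.

Arguments ccvg_cst {R T F FF} a [t] _.

(** * Convergence of the tails with positive coefficients *)

Section Tails.
Variable R : realType.
Local Notation C := (R[i]).

(** The induction step of [tail_cauchy]: [2 i u] is bounded by [K (x + y)]
    because its square is. *)
Lemma square_step (i u K x y : R) : 0 <= i -> 0 <= u -> u <= K -> 0 <= x ->
  0 <= y -> i ^+ 2 * u <= K * (x * y) ->
  (i + 1) ^+ 2 * u <= K * ((1 + x) * (1 + y)).
Proof.
move=> i0 u0 uK x0 y0 H.
have K0 : 0 <= K by exact: le_trans uK.
have : 2 * i * u <= K * (x + y).
  rewrite -ler_sqr ?nnegrE ?mulr_ge0 ?addr_ge0//.
  have H1 : i ^+ 2 * u * u <= K * (x * y) * K by rewrite ler_pM ?mulr_ge0 ?exprn_ge0.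
  have H2 : 0 <= K ^+ 2 * (x - y) ^+ 2 by rewrite mulr_ge0 ?sqr_ge0.
  nra.
move=> H3; nra.
Qed.

Lemma square_stepC (i : nat) (u K x y : C) : 0 <= u -> u <= K -> 0 <= x ->
  0 <= y -> i%:R ^+ 2 * u <= K * (x * y) ->
  i.+1%:R ^+ 2 * u <= K * ((1 + x) * (1 + y)).
Proof.
move=> u0 uK; have /ge0_complex[k k0 Kk] : 0 <= K by exact: le_trans uK.
case/ge0_complex: u0 uK => v v0 ->; rewrite Kk lecR => uk.
case/ge0_complex => p p0 -> /ge0_complex[q q0 ->].
have -> : i%:R ^+ 2 * v%:C%C = (i%:R ^+ 2 * v)%:C%C :> C.
  by rewrite rmorphM rmorphXn rmorph_nat.
have -> : i.+1%:R ^+ 2 * v%:C%C = ((i%:R + 1) ^+ 2 * v)%:C%C :> C.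
  by rewrite rmorphM rmorphXn rmorphD rmorph_nat rmorph1 natr1.
have -> : k%:C%C * (p%:C%C * q%:C%C) = (k * (p * q))%:C%C :> C.
  by rewrite !rmorphM.
have -> : k%:C%C * ((1 + p%:C%C) * (1 + q%:C%C)) =
    (k * ((1 + p) * (1 + q)))%:C%C :> C.
  by rewrite !(rmorphM, rmorphD, rmorph1).
rewrite !lecR; exact: square_step.
Qed.

(** Two levels of the energy identity.  Each pair of levels contributes a term
    [1 +] to both energies, which is what raises the factor from [i] to [i + 1]. *)
Lemma tail_sub_step (z f g h f' g' h' a b K : C) (i : nat) :
  0 < a -> 0 < b -> z - z^* != 0 ->
  f * (1 - z * g) = a -> f' * (1 - z * g') = a ->
  g * (1 - z * h) = b -> g' * (1 - z * h') = b ->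
  0 <= (z * h - (z * h)^*) / (z - z^*) ->
  0 <= (z * h' - (z * h')^*) / (z - z^*) ->
  `|z| ^+ 2 * `|z * g - z * g'| ^+ 2 <= K ->
  i%:R ^+ 2 * `|z * h - z * h'| ^+ 2 <=
    K * ((z * h - (z * h)^*) / (z - z^*) * ((z * h' - (z * h')^*) / (z - z^*))) ->
  i.+1%:R ^+ 2 * `|z * f - z * f'| ^+ 2 <=
    K * ((z * f - (z * f)^*) / (z - z^*) * ((z * f' - (z * f')^*) / (z - z^*))).
Proof.
move=> a_gt0 b_gt0 zz fg fg' gh gh' h0 h0' d1K IH.
have [a0 b0] := (lt0r_neq0 a_gt0, lt0r_neq0 b_gt0).
have [ar br] := (gtr0_real a_gt0, gtr0_real b_gt0).
rewrite (energyL a0 ar zz fg) (energyL a0 ar zz fg').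
rewrite (energyK b0 br gh) (energyK b0 br gh').
have na : `|a| = a by rewrite gtr0_norm.
have nb : `|b| = b by rewrite gtr0_norm.
rewrite -mulrBr (tail_sub a0 fg fg').
have e1 := tail_sub b0 gh gh'.
rewrite -mulrBr normrM in d1K.
set n := (z * h - _) / _ in h0 IH *; set n' := (z * h' - _) / _ in h0' IH *.
have := @square_stepC i (`|z| ^+ 2 * (`|z| * `|g - g'|) ^+ 2) K
  (`|z| ^+ 2 * (`|g| ^+ 2 / b * n)) (`|z| ^+ 2 * (`|g'| ^+ 2 / b * n')).
move=> H; rewrite -mulrBr !normrM normfV na.
rewrite [X in X <= _](_ : _ = (`|f| * `|f'| / a) ^+ 2 *
   (i.+1%:R ^+ 2 * (`|z| ^+ 2 * (`|z| * `|g - g'|) ^+ 2))); last by ring.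
rewrite [X in _ <= X](_ : _ = (`|f| * `|f'| / a) ^+ 2 *
   (K * ((1 + `|z| ^+ 2 * (`|g| ^+ 2 / b * n)) *
         (1 + `|z| ^+ 2 * (`|g'| ^+ 2 / b * n'))))); last by ring.
apply: ler_wpM2l; first by rewrite exprn_ge0// divr_ge0 ?mulr_ge0// ltW.
have b0' := ltW b_gt0.
apply: H.
- by rewrite mulr_ge0 ?exprn_ge0 ?mulr_ge0.
- exact: d1K.
- by rewrite mulr_ge0 ?exprn_ge0// mulr_ge0// divr_ge0 ?exprn_ge0.
- by rewrite mulr_ge0 ?exprn_ge0// mulr_ge0// divr_ge0 ?exprn_ge0.
rewrite e1 !normrM normfV nb.
rewrite [X in X <= _](_ : _ = (`|z| ^+ 2 * `|g| * `|g'| / b) ^+ 2 *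
   (i%:R ^+ 2 * `|z * h - z * h'| ^+ 2)); last by ring.
rewrite [X in _ <= X](_ : _ = (`|z| ^+ 2 * `|g| * `|g'| / b) ^+ 2 *
   (K * (n * n'))); last by ring.
apply: ler_wpM2l; last exact: IH.
by rewrite exprn_ge0// divr_ge0// !mulr_ge0// exprn_ge0.
Qed.

Variable alpha : nat -> R.

(** With the value 0 at depth 0, every approximant has the form
    [a / (1 - z g)] where [g] is the next one. *)
Definition tail_next (z : C) k d : C :=
  if d is d'.+1 then cfrac_tail alpha z k.+1 d' else 0.

Lemma cfrac_tail_conj z k d : cfrac_tail alpha z^* k d = (cfrac_tail alpha z k d)^*.
Proof.
elim: d k => [|d IH] k /=; first by rewrite conj_realC.
by rewrite IH fmorph_div /= rmorphB rmorphM rmorph1 conj_realC.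
Qed.

Lemma cfrac_tailE z k d :
  cfrac_tail alpha z k d = (alpha k)%:C%C / (1 - z * tail_next z k d).
Proof. by case: d => [|d] //=; rewrite mulr0 subr0 divr1. Qed.

(** At index 0 this is the continued fraction itself. *)
Definition tail_lim k (z : C) : C :=
  lim ((cfrac_tail alpha z k n : R[i]^o) @[n --> \oo]).

Section PositiveTail.
Variable E : nat.
Hypothesis alpha_pos : forall k, (E <= k)%N -> 0 < alpha k.

Lemma alphaC_gt0 k : (E <= k)%N -> 0 < (alpha k)%:C%C :> C.
Proof. by move=> Ek; rewrite realC_gt0 alpha_pos. Qed.

(** Positivity goes up the levels of the approximant, starting from [g = 0];
    the positivity at each level also keeps the next denominator away from 0. *)
Lemma tail_psd n (z : 'I_n -> C) : (forall i j, z i - (z j)^* != 0) ->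
  forall d k, (E <= k)%N ->
  psd (pick_kernel z (fun i => cfrac_tail alpha (z i) k d)) /\
  psd (pick_kernel z (fun i => z i * cfrac_tail alpha (z i) k d)).
Proof.
move=> zz d k Ek.
have step k' d' : (E <= k')%N ->
    psd (pick_kernel z (fun i => tail_next (z i) k' d')) /\
    psd (pick_kernel z (fun i => z i * tail_next (z i) k' d')) ->
    psd (pick_kernel z (fun i => cfrac_tail alpha (z i) k' d')) /\
    psd (pick_kernel z (fun i => z i * cfrac_tail alpha (z i) k' d')).
  move=> Ek' [psK psL].
  have rel i : cfrac_tail alpha (z i) k' d' * (1 - z i * tail_next (z i) k' d') =
      (alpha k')%:C%C.
    by rewrite cfrac_tailE divfK// tail_denom_neq0//; exact: (psd_diag i psK).
  have a0 := alphaC_gt0 Ek'.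
  split; first exact: (psd_pickK (lt0r_neq0 a0) (gtr0_real a0) rel a0 psL).
  exact: (psd_pickL zz (lt0r_neq0 a0) (gtr0_real a0) rel a0 psK).
elim: d k Ek => [|d IH] k Ek; apply: step => //=; last exact/IH/leqW.
have p0 (f : 'I_n -> C) : (forall i, f i = 0) -> psd (pick_kernel z f).
  move=> f0 x; rewrite (@eq_qform _ _ _ (fun=> fun=> 0 * 0)); last first.
    by move=> i j; rewrite /pick_kernel !f0 conjC0 subrr !mul0r.
  by rewrite qformZ mul0r.
by split; apply: p0 => // i; rewrite mulr0.
Qed.

Lemma tail_diag z d k : z - z^* != 0 -> (E <= k)%N ->
  0 <= (cfrac_tail alpha z k d - (cfrac_tail alpha z k d)^*) / (z - z^*) /\
  0 <= (z * cfrac_tail alpha z k d - (z * cfrac_tail alpha z k d)^*) / (z - z^*).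
Proof.
move=> zz Ek; have [p1 p2] := @tail_psd 1 (fun=> z) (fun _ _ => zz) d k Ek.
by split; [exact: (psd_diag ord0 p1)|exact: (psd_diag ord0 p2)].
Qed.

Lemma tail_next_diag z d k : z - z^* != 0 -> (E <= k)%N ->
  0 <= (tail_next z k d - (tail_next z k d)^*) / (z - z^*).
Proof.
move=> zz Ek; case: d => [|d] /=; first by rewrite conjC0 subrr mul0r.
exact: (tail_diag d zz (leqW Ek)).1.
Qed.

Lemma tail_rel z d k : z - z^* != 0 -> (E <= k)%N ->
  cfrac_tail alpha z k d * (1 - z * tail_next z k d) = (alpha k)%:C%C.
Proof.
by move=> zz Ek; rewrite cfrac_tailE divfK// tail_denom_neq0// tail_next_diag.
Qed.

Variable A : R.
Hypothesis alpha_le : forall k, `|alpha k| <= A.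

Lemma tail_le z d k : z - z^* != 0 -> (E <= k)%N ->
  `|cfrac_tail alpha z k d| <= A%:C%C * (2 * `|z| / `|z - z^*|).
Proof.
move=> zz Ek; apply: (tail_bound (alphaC_gt0 Ek) _ zz (tail_rel d zz Ek)).
  by rewrite lecR (le_trans (ler_norm _)).
exact: tail_next_diag.
Qed.

(** The energies on the right are bounded, so that approximants of depth at
    least [2 i] differ by [O(1 / i)]. *)
Lemma tail_cauchy z i n m k : z - z^* != 0 -> (E <= k)%N ->
  (i.*2 <= n)%N -> (i.*2 <= m)%N ->
  let f := cfrac_tail alpha z k n in let f' := cfrac_tail alpha z k m in
  let B := A%:C%C * (2 * `|z| / `|z - z^*|) in
  i%:R ^+ 2 * `|z * f - z * f'| ^+ 2 <= (`|z| * (`|z| * (2 * B))) ^+ 2 *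
    ((z * f - (z * f)^*) / (z - z^*) * ((z * f' - (z * f')^*) / (z - z^*))).
Proof.
move=> zz; elim: i n m k => [|i IH] n m k Ek.
  have B0 := le_trans (normr_ge0 _) (tail_le 0 zz Ek).
  move=> _ _ /=; rewrite expr0n mul0r mulr_ge0//.
    move: B0; set B := _ * (_ / _); move: B => B B0.
    by rewrite exprn_ge0// !mulr_ge0.
  by rewrite mulr_ge0// ?(tail_diag n zz Ek).2 ?(tail_diag m zz Ek).2.
have B0 := le_trans (normr_ge0 _) (tail_le 0 zz Ek).
case: n => [|[|n]] //; case: m => [|[|m]] //; rewrite doubleS !ltnS => ni mi.
cbv zeta; move: B0; set B := A%:C%C * _ => B0.
have [E1 E2] : (E <= k.+1)%N /\ (E <= k.+2)%N by split; lia.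
apply: (tail_sub_step (alphaC_gt0 Ek) (alphaC_gt0 E1) zz
  (tail_rel n.+2 zz Ek) (tail_rel m.+2 zz Ek)
  (tail_rel n.+1 zz E1) (tail_rel m.+1 zz E1)
  (tail_diag n zz E2).2 (tail_diag m zz E2).2 _ (IH n m k.+2 E2 ni mi)).
rewrite [(_ * (_ * _)) ^+ 2]exprMn ler_wpM2l ?exprn_ge0//.
rewrite ler_pXn2r ?nnegrE//; last first.
  by rewrite mulr_ge0// mulr_ge0.
rewrite -mulrBr normrM ler_wpM2l// (le_trans (ler_normB _ _))//.
by rewrite mulr_natl mulr2n lerD// tail_le.
Qed.

Lemma tail_cvg z k : z - z^* != 0 -> (E <= k)%N ->
  (cfrac_tail alpha z k n : R[i]^o) @[n --> \oo] --> (tail_lim k z : R[i]^o).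
Proof.
move=> zz Ek.
pose B : C := A%:C%C * (2 * `|z| / `|z - z^*|).
have z0 : z != 0 by apply: contraNneq zz => ->; rewrite conjC0 subr0.
have z_gt0 : 0 < `|z| by rewrite normr_gt0.
have B0 : 0 <= B by exact: le_trans (normr_ge0 _) (tail_le 0 zz Ek).
pose M : C := (2 * B) * `|z| * (2 * `|z| * B / `|z - z^*|).
have M0 : 0 <= M.
  apply: mulr_ge0; first by apply: mulr_ge0 => //; exact: mulr_ge0.
  by apply: divr_ge0 => //; apply: mulr_ge0 => //; exact: mulr_ge0.
have [M' _ MM'] := ge0_complex M0.
apply: (@cvgn_harmonic _ (cfrac_tail alpha z k) M') => i n m ni mi.
have := tail_cauchy zz Ek ni mi; cbv zeta; rewrite -/B.
set f := cfrac_tail alpha z k n; set f' := cfrac_tail alpha z k m => H.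
have Nle d : (z * cfrac_tail alpha z k d - (z * cfrac_tail alpha z k d)^*) /
   (z - z^*) <= 2 * `|z| * B / `|z - z^*|.
  apply: le_trans (real_ler_norm _) _.
    by rewrite ger0_real// (tail_diag d zz Ek).2.
  rewrite normrM normfV ler_pM2r ?invr_gt0 ?normr_gt0//.
  apply: le_trans (ler_normB _ _) _; rewrite norm_conjC normrM -mulr2n -mulrA.
  by rewrite mulr_natl lerMn2r /= ler_wpM2l// tail_le.
rewrite -MM' -(ler_pM2l z_gt0) mulrCA -normrM mulrBr.
rewrite -ler_sqr ?nnegrE; [|by apply: mulr_ge0|by apply: mulr_ge0]. rewrite exprMn.
apply: (le_trans H).
rewrite [X in _ <= X](_ : _ = (`|z| * (`|z| * (2 * B))) ^+ 2 *
  (2 * `|z| * B / `|z - z^*| * (2 * `|z| * B / `|z - z^*|))); last first.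
  by rewrite /M; ring.
apply: ler_wpM2l.
  by apply/exprn_ge0/mulr_ge0 => //; apply: mulr_ge0 => //; exact: mulr_ge0.
by apply: ler_pM; rewrite ?(tail_diag n zz Ek).2 ?(tail_diag m zz Ek).2// Nle.
Qed.

End PositiveTail.
End Tails.

(** * Differentiability from the positivity of Pick kernels *)

Section PickDerivable.
Variable R : realType.
Local Notation C := (R[i]).
Variable f : C -> C.
Local Notation N x y := ((f x - (f y)^*) / (x - y^*)).

Hypothesis f_psd : forall n (z : 'I_n -> C), (forall i j, z i - (z j)^* != 0) ->
  psd (pick_kernel z (fun i => f (z i))).

Lemma pick_cauchy_schwarz (x y : C) : x - x^* != 0 -> y - y^* != 0 ->
  x - y^* != 0 -> `|N x y| ^+ 2 <= N x x * N y y.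
Proof.
move=> xx yy xy.
have yx : y - x^* != 0 by rewrite -conjC_eq0 rmorphB /= conjCK -opprB oppr_eq0.
have p (s t : C) : 0 <= qform (pick_kernel (fun i : 'I_2 => nth 0 [:: x; y] i)
    (fun i => f (nth 0 [:: x; y] i))) (fun i => nth 0 [:: s; t] i).
  by apply: f_psd; case=> [[|[|i]] Hi] [[|[|j]] Hj].
have e (s t : C) : qform (pick_kernel (fun i : 'I_2 => nth 0 [:: x; y] i)
    (fun i => f (nth 0 [:: x; y] i))) (fun i => nth 0 [:: s; t] i) =
    s * s^* * N x x + s * t^* * N x y + s^* * t * (N x y)^* + t * t^* * N y y.
  rewrite pick_herm /qform !big_ord_recl !big_ord0 /= /pick_kernel /= !addr0.
  ring.
rewrite normCK; apply: psd2_le.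
- exact: (psd_diag ord0 (@f_psd 1 (fun=> x) (fun _ _ => xx))).
- exact: (psd_diag ord0 (@f_psd 1 (fun=> y) (fun _ _ => yy))).
by move=> s t; rewrite -e; exact: p.
Qed.

(** Positivity at the points [x], [y], [v] with coefficients [s], [- s], [t]. *)
Lemma pick_cauchy_schwarz3 (x y v : C) : x - x^* != 0 -> y - y^* != 0 ->
  v - v^* != 0 -> x - y^* != 0 -> x - v^* != 0 -> y - v^* != 0 ->
  `|N x v - N y v| ^+ 2 <= (N x x - N x y - N y x + N y y) * N v v.
Proof.
move=> xx yy vv xy xv yv.
have sym (a b : C) : a - b^* != 0 -> b - a^* != 0.
  by rewrite -conjC_eq0 rmorphB /= conjCK -opprB oppr_eq0.
have p (s s' t : C) : 0 <= qform (pick_kernel (fun i : 'I_3 => nth 0 [:: x; y; v] i)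
    (fun i => f (nth 0 [:: x; y; v] i))) (fun i => nth 0 [:: s; s'; t] i).
  by apply: f_psd; case=> [[|[|[|i]]] Hi] [[|[|[|j]]] Hj] //=; exact: sym.
have e (s t : C) : qform (pick_kernel (fun i : 'I_3 => nth 0 [:: x; y; v] i)
    (fun i => f (nth 0 [:: x; y; v] i))) (fun i => nth 0 [:: s; - s; t] i) =
    s * s^* * (N x x - N x y - N y x + N y y) + s * t^* * (N x v - N y v) +
    s^* * t * (N x v - N y v)^* + t * t^* * N v v.
  have -> : (N x v - N y v)^* = N v x - N v y.
    by rewrite -(pick_herm (f x)) -(pick_herm (f y)); exact: rmorphB.
  rewrite /qform !big_ord_recl !big_ord0 /= /pick_kernel /= !addr0 !rmorphN.
  ring.
rewrite normCK; apply: psd2_le.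
- have := p 1 (- 1) 0; rewrite e rmorph1 conjC0 !(mul0r, mulr0, mul1r, addr0).
  exact.
- exact: (psd_diag ord0 (@f_psd 1 (fun=> v) (fun _ _ => vv))).
by move=> s t; rewrite -e; exact: p.
Qed.

Hypothesis f_conj : forall z, z - z^* != 0 -> f z^* = (f z)^*.

(** For [v = w^*] the kernel [N x v] is the difference quotient of [f] between
    [x] and [w].  By [pick_cauchy_schwarz] these quotients are bounded, so [f] is
    continuous at [w]; then the second difference of the kernel in
    [pick_cauchy_schwarz3] tends to 0 and the quotients are Cauchy. *)
Lemma pick_derivable (w : C) (M : C) : w - w^* != 0 ->
  (\forall z \near (w : R[i]^o), `|f z| <= M) ->
  derivable (f : R[i]^o -> R[i]^o) w 1.
Proof.
move=> ww fM.
pose z (h : R[i]^o) : C := h + w.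
have wcww : w^* - w^*^* != 0 by rewrite -rmorphB conjC_eq0.
pose F := (0 : R[i]^o)^'.
have zw : (z : R[i]^o -> R[i]^o) @ F --> (w : R[i]^o).
  have hF : (fun h : C => h : R[i]^o) @ F --> (0 : R[i]^o) by exact: cvg_within.
  exact: (ccvg_eq (ccvgD hF (ccvg_cst w)) (add0r w)).
have zzw : (fun h => z h - (z h)^* : R[i]^o) @ F --> (w - w^* : R[i]^o).
  exact: (ccvgB zw (ccvg_conj zw)).
have zM : \forall h \near F, `|f (z h)| <= M by exact: zw fM.
have zz0 : \forall h \near F, z h - (z h)^* != 0 by exact: (ccvg_neq0 ww zzw).
have h0 : \forall h \near F, h != 0 by exact: nbhs_dnbhs_neq.
have NwE x : N x w^* = (f x - f w) / (x - w) by rewrite f_conj// !conjCK.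
have fzw : (fun h => f (z h) : R[i]^o) @ F --> (f w : R[i]^o).
  apply/cvgrPdist_lt => e e0.
  have [N0 N0E] : exists x, x = N w^* w^* by eexists.
  pose g (h : R[i]^o) : C := h * h * (M *+ 2) * (z h - (z h)^*)^-1 * N0.
  have hF : (fun h : C => h : R[i]^o) @ F --> (0 : R[i]^o) by exact: cvg_within.
  have gF : (fun h => g h : R[i]^o) @ F --> (0 : R[i]^o).
    apply: (ccvg_eq (ccvgM (ccvgM (ccvgM (ccvgM hF hF) (ccvg_cst (M *+ 2)))
      (ccvgV ww zzw)) (ccvg_cst N0))).
    by rewrite !mul0r.
  have e2 : 0 < e ^+ 2 by rewrite exprn_gt0.
  near=> h.
  have hn0 : h != 0 by near: h; exact: h0.
  have zn0 : z h - (z h)^* != 0 by near: h; exact: zz0.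
  have fzM : `|f (z h)| <= M by near: h; exact: zM.
  have gh : `|0 - g h| < e ^+ 2 by near: h; exact: (ccvg_near gF e2).
  have zwh : z h - w = h by rewrite /z addrK.
  have zwc : z h - w^*^* != 0 by rewrite conjCK zwh.
  have H := pick_cauchy_schwarz zn0 wcww zwc.
  rewrite NwE zwh in H.
  rewrite distrC -ltr_sqr ?nnegrE// ?(ltW e0)//; apply: le_lt_trans gh.
  rewrite sub0r normrN /g !normrM.
  have -> : f (z h) - f w = h * ((f (z h) - f w) / h) by rewrite mulrC divfK.
  rewrite normrM exprMn expr2 -!mulrA; do 2 apply: ler_wpM2l => //.
  apply: le_trans H _; apply: le_trans (real_ler_norm _) _.
    apply: realM; apply: ger0_real.
      exact: (psd_diag ord0 (@f_psd 1 (fun=> z h) (fun _ _ => zn0))).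
    exact: (psd_diag ord0 (@f_psd 1 (fun=> w^*) (fun _ _ => wcww))).
  rewrite -N0E normrM [X in _ <= X]mulrA; apply: ler_wpM2r => //.
  rewrite normrM; apply: ler_wpM2r => //.
  apply: le_trans (ler_normB _ _) _; rewrite norm_conjC -mulr2n normrMn.
  rewrite lerMn2r /= (le_trans fzM)// real_ler_norm// ger0_real//.
  exact: le_trans fzM.
have cvgu : cvg ((fun h => (f (z h) - f w) / h : R[i]^o) @ F).
  apply: cauchy_complex_cvg => e e0.
  pose F2 := filter_prod F F.
  have z1 : (fun p : C * C => z p.1 : R[i]^o) @ F2 --> (w : R[i]^o).
    exact: (cvg_comp _ _ cvg_fst zw).
  have z2 : (fun p : C * C => z p.2 : R[i]^o) @ F2 --> (w : R[i]^o).
    exact: (cvg_comp _ _ cvg_snd zw).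
  have f1 : (fun p : C * C => f (z p.1) : R[i]^o) @ F2 --> (f w : R[i]^o).
    exact: (cvg_comp _ _ cvg_fst fzw).
  have f2 : (fun p : C * C => f (z p.2) : R[i]^o) @ F2 --> (f w : R[i]^o).
    exact: (cvg_comp _ _ cvg_snd fzw).
  have Ncvg (x y : C * C -> C) : (x : _ -> R[i]^o) @ F2 --> (w : R[i]^o) ->
      (y : _ -> R[i]^o) @ F2 --> (w : R[i]^o) ->
      (fun p => f (x p) : R[i]^o) @ F2 --> (f w : R[i]^o) ->
      (fun p => f (y p) : R[i]^o) @ F2 --> (f w : R[i]^o) ->
      (fun p => N (x p) (y p) : R[i]^o) @ F2 --> (N w w : R[i]^o).
    move=> xw yw fx fy.
    exact: (ccvgM (ccvgB fx (ccvg_conj fy))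
      (ccvgV ww (ccvgB xw (ccvg_conj yw)))).
  have [N0 N0E] : exists x, x = N w^* w^* by eexists.
  pose S (p : C * C) := (N (z p.1) (z p.1) - N (z p.1) (z p.2) -
    N (z p.2) (z p.1) + N (z p.2) (z p.2)) * N0.
  have S0 : (fun p => S p : R[i]^o) @ F2 --> (0 : R[i]^o).
    apply: (ccvg_eq (ccvgM (ccvgD (ccvgB (ccvgB (Ncvg _ _ z1 z1 f1 f1)
      (Ncvg _ _ z1 z2 f1 f2)) (Ncvg _ _ z2 z1 f2 f1)) (Ncvg _ _ z2 z2 f2 f2))
      (ccvg_cst N0))).
    by rewrite subrr sub0r addNr mul0r.
  have e2 : 0 < (e%:C%C : C) ^+ 2 by rewrite exprn_gt0// realC_gt0.
  have P1 : \forall p \near F2, `|0 - S p| < (e%:C%C : C) ^+ 2.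
    exact: ccvg_near S0 e2.
  have P2 : \forall p \near F2, z p.1 - (z p.2)^* != 0.
    exact: (ccvg_neq0 ww (ccvgB z1 (ccvg_conj z2))).
  have P3 : \forall p \near F2, z p.1 - (z p.1)^* != 0 by exact: (cvg_fst zz0).
  have P4 : \forall p \near F2, z p.2 - (z p.2)^* != 0 by exact: (cvg_snd zz0).
  have P5 : \forall p \near F2, p.1 != 0 :> C by exact: (cvg_fst h0).
  have P6 : \forall p \near F2, p.2 != 0 :> C by exact: (cvg_snd h0).
  have [[A B] /= [FA FB] AB] :=
    filterI (filterI P1 P2) (filterI (filterI P3 P4) (filterI P5 P6)).
  exists (A `&` B); first exact: filterI.
  move=> x y [Ax Bx] [Ay By].
  have [[/= Sxy xy] [[xx yy] [xn0 yn0]]] := AB (x, y) (conj Ax By).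
  have zwh h : z h - w = h by rewrite /z addrK.
  have H := @pick_cauchy_schwarz3 (z x) (z y) w^* xx yy wcww xy.
  rewrite !conjCK !zwh in H; have {H} := H xn0 yn0.
  have -> : (f (z x) - (f w^*)^*) / x = (f (z x) - f w) / x by rewrite f_conj// conjCK.
  have -> : (f (z y) - (f w^*)^*) / y = (f (z y) - f w) / y by rewrite f_conj// conjCK.
  move=> H; rewrite -ltr_sqr ?nnegrE// ?ltW ?realC_gt0//.
  apply: le_lt_trans (le_trans H (real_ler_norm _)) _.
    by apply: ger0_real; apply: le_trans H; exact: exprn_ge0.
  by move: Sxy; rewrite sub0r normrN /S /= N0E conjCK.
have e : (fun h => (f (z h) - f w) / h : R[i]^o) =
    (fun h : R[i]^o => h^-1 *: ((f (h *: (1 : R[i]^o) + w) : R[i]^o) - f w)).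
  apply/funext => h; rewrite /z mulrC; congr (_ *: (f (_ + _) - _)).
  exact: (esym (mulr1 (h : C))).
by move: cvgu; rewrite e.
Unshelve. all: by end_near.
Qed.

End PickDerivable.

Section LimitForms.
Variable R : realType.
Local Notation C := (R[i]).

Lemma ccvg_sum (T : Type) (F : set_system T) (FF : Filter F) (I : Type)
    (r : seq I) (f : I -> T -> C) (a : I -> C) :
  (forall i, (f i : T -> R[i]^o) @ F --> (a i : R[i]^o)) ->
  (fun t => \sum_(i <- r) f i t : R[i]^o) @ F --> (\sum_(i <- r) a i : R[i]^o).
Proof.
move=> fa; elim: r => [|i r IH].
  rewrite big_nil; under eq_fun do rewrite big_nil.
  exact: ccvg_cst.
rewrite big_cons; under eq_fun do rewrite big_cons.
exact: (ccvgD (fa i) IH).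
Qed.

Lemma psd_pick_lim n (z : 'I_n -> C) (f : nat -> 'I_n -> C) (g : 'I_n -> C) :
  (forall i, (fun d => f d i : R[i]^o) @ \oo --> (g i : R[i]^o)) ->
  (forall d, psd (pick_kernel z (f d))) -> psd (pick_kernel z g).
Proof.
move=> fg fpsd x.
apply: (@le_lim_ge0 _ (fun d => qform (pick_kernel z (f d)) x)); last first.
  by move=> d; exact: fpsd.
apply: ccvg_sum => i; apply: ccvg_sum => j.
exact: (ccvgM (ccvg_cst (x i * (x j)^*))
  (ccvgM (ccvgB (fg i) (ccvg_conj (fg j))) (ccvg_cst (z i - (z j)^*)^-1))).
Qed.

End LimitForms.

Section TailLimits.
Variables (R : realType) (alpha : nat -> R) (E : nat) (A : R).
Local Notation C := (R[i]).
Hypothesis alpha_pos : forall k, (E <= k)%N -> 0 < alpha k.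
Hypothesis alpha_le : forall k, `|alpha k| <= A.
Local Notation a k := ((alpha k)%:C%C : C).
Local Notation t := (tail_lim alpha).

Let cvgt z k zz Ek := @tail_cvg R alpha E alpha_pos A alpha_le z k zz Ek.

Lemma tail_lim_rel z k : z - z^* != 0 -> (E <= k)%N ->
  t k z * (1 - z * t k.+1 z) = a k.
Proof.
move=> zz Ek.
have c1 := cvgt zz Ek.
have c2 : (fun n => cfrac_tail alpha z k n.+1 : R[i]^o) @ \oo --> (t k z : R[i]^o).
  by rewrite -cvg_shiftS in c1.
have c3 : (fun n => cfrac_tail alpha z k n.+1 *
    (1 - z * cfrac_tail alpha z k.+1 n) : R[i]^o) @ \oo -->
    (t k z * (1 - z * t k.+1 z) : R[i]^o).
  exact: (ccvgM c2 (ccvgB (ccvg_cst 1) (ccvgM (ccvg_cst z) (cvgt zz (leqW Ek))))).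
apply: (ccvg_unique _ c3).
have -> : (fun n => cfrac_tail alpha z k n.+1 * (1 - z * cfrac_tail alpha z k.+1 n))
    = (fun=> a k).
  by apply/funext => n; exact: (tail_rel alpha_pos n.+1 zz Ek).
exact: ccvg_cst.
Qed.

Lemma tail_lim_conj z k : z - z^* != 0 -> (E <= k)%N -> t k z^* = (t k z)^*.
Proof.
move=> zz Ek.
have zz' : z^* - z^*^* != 0 by rewrite -rmorphB conjC_eq0.
apply: (ccvg_unique _ (cvgt zz' Ek)).
have -> : (fun n => cfrac_tail alpha z^* k n) = (fun n => (cfrac_tail alpha z k n)^*).
  by apply/funext => n; exact: cfrac_tail_conj.
exact: (ccvg_conj (cvgt zz Ek)).
Qed.

Section Points.
Variables (n : nat) (z : 'I_n -> C).
Hypothesis zz : forall i j, z i - (z j)^* != 0.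

Lemma tail_lim_psdK k : (E <= k)%N -> psd (pick_kernel z (fun i => t k (z i))).
Proof.
move=> Ek; apply: (@psd_pick_lim _ _ _ (fun d i => cfrac_tail alpha (z i) k d)).
  by move=> i; exact: (cvgt (zz i i) Ek).
by move=> d; exact: (tail_psd alpha_pos zz d Ek).1.
Qed.

Lemma tail_lim_psdL k : (E <= k)%N ->
  psd (pick_kernel z (fun i => z i * t k (z i))).
Proof.
move=> Ek; apply: (@psd_pick_lim _ _ _ (fun d i => z i * cfrac_tail alpha (z i) k d)).
  by move=> i; exact: (ccvgM (ccvg_cst (z i)) (cvgt (zz i i) Ek)).
by move=> d; exact: (tail_psd alpha_pos zz d Ek).2.
Qed.

End Points.

Lemma tail_lim_le z k : z - z^* != 0 -> (E <= k)%N ->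
  `|t k z| <= A%:C%C * (2 * `|z| / `|z - z^*|).
Proof.
move=> zz Ek; apply: (tail_bound _ _ zz (tail_lim_rel zz Ek)).
- exact: (alphaC_gt0 alpha_pos).
- by rewrite lecR (le_trans (ler_norm _)).
- exact: (psd_diag ord0 (@tail_lim_psdK 1 (fun=> z) (fun _ _ => zz) k.+1 (leqW Ek))).
Qed.

Lemma tail_lim_derivable w k : w - w^* != 0 -> (E <= k)%N ->
  derivable (t k : R[i]^o -> R[i]^o) w 1.
Proof.
move=> ww Ek.
have wF : (fun z : C => z : R[i]^o) @ (w : R[i]^o) --> (w : R[i]^o) by exact: cvg_id.
have c : (fun z : C => A%:C%C * 2 * (z / (z - z^*)) : R[i]^o) @ (w : R[i]^o) -->
    (A%:C%C * 2 * (w / (w - w^*)) : R[i]^o).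
  exact: (ccvgM (ccvg_cst _) (ccvgM wF (ccvgV ww (ccvgB wF (ccvg_conj wF))))).
have N0 : \forall z \near (w : R[i]^o), z - z^* != 0.
  exact: (ccvg_neq0 ww (ccvgB wF (ccvg_conj wF))).
have B : \forall z \near (w : R[i]^o), `|A%:C%C * 2 * (z / (z - z^*))| <=
    `|A%:C%C * 2 * (w / (w - w^*))| + 1 by exact: (ccvg_bounded c).
apply: (@pick_derivable _ _ _ _ w (`|A%:C%C * 2 * (w / (w - w^*))| + 1) ww).
- by move=> n z zz; exact: tail_lim_psdK.
- by move=> z zz; exact: tail_lim_conj.
apply: filterS (filterI N0 B) => z [zz zB].
apply: le_trans (tail_lim_le zz Ek) (le_trans _ zB).
have A0 : 0 <= (A%:C%C : C) by rewrite ler0c (le_trans (normr_ge0 _) (alpha_le 0)).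
by rewrite !normrM normfV (ger0_norm A0) gtr0_norm// !mulrA.
Qed.

End TailLimits.

(** * Strict positivity *)

Section Strictness.
Variable C : numClosedFieldType.

(** The recurrences turn orthogonality of [x] to all [w j] with [j >= m] into
    orthogonality of [x / z] to all [w j] with [j > m].  So [x] may be multiplied by
    any polynomial in [1 / z], in particular by one that vanishes at all points but
    one, and then [w j k != 0] forces [x k = 0]. *)
Lemma orthogonal_shift n (z x : 'I_n -> C) (w v : nat -> 'I_n -> C)
    (b c : nat -> C) :
  injective z -> (forall j i, w j i != 0) ->
  (forall j i, w j i = v j i - b j * w j.+1 i) ->
  (forall j i, w j.+1 i / z i = v j i + c j * v j.+1 i) ->
  (forall j, \sum_i x i * w j i = 0) -> forall i, x i = 0.
Proof.
move=> z_inj w0 wv vw xw k.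
(* Division by z costs one index, so only tails of the sequence w are used. *)
pose P m (y : 'I_n -> C) := forall j, (m <= j)%N -> \sum_i y i * w j i = 0.
have shift m y : P m y -> P m.+1 (fun i => y i / z i).
  move=> Py [//|j] mj.
  have yv j' : (m <= j')%N -> \sum_i y i * v j' i = 0.
    move=> mj'.
    transitivity (\sum_i y i * w j' i + b j' * \sum_i y i * w j'.+1 i).
      rewrite mulr_sumr -big_split; apply: eq_bigr => i _ /=.
      by rewrite [w j' i]wv; ring.
    by rewrite !Py ?mulr0 ?addr0// leqW.
  transitivity (\sum_i y i * v j i + c j * \sum_i y i * v j.+1 i).
    rewrite mulr_sumr -big_split; apply: eq_bigr => i _ /=.
    by rewrite mulrAC -mulrA vw; ring.
  by rewrite !yv ?mulr0 ?addr0// leqW.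
(* Multiplying by 1 / z - 1 / z l removes the point of index l from x. *)
have kill (s : seq 'I_n) :
    P (size s) (fun i => x i * \prod_(l <- s) ((z i)^-1 - (z l)^-1)).
  elim: s => [|l s IH].
    by move=> j _; under eq_bigr do rewrite big_nil mulr1.
  move=> j sj; have sj' := ltnW sj.
  transitivity (\sum_i x i * \prod_(l <- s) ((z i)^-1 - (z l)^-1) / z i * w j i -
      (z l)^-1 * \sum_i x i * \prod_(l <- s) ((z i)^-1 - (z l)^-1) * w j i).
    rewrite mulr_sumr -sumrB; apply: eq_bigr => i _.
    by rewrite big_cons; ring.
  by rewrite (shift _ _ IH _ sj) IH// mulr0 subr0.
have [s sE] : exists s : seq 'I_n, forall l, (l \in s) = (l != k).
  by exists [seq l <- enum 'I_n | l != k] => l; rewrite mem_filter mem_enum andbT.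
have := kill s _ (leqnn _); rewrite (bigD1 k) //= [X in _ + X]big1 => [|i ik]; last first.
  suff -> : \prod_(l <- s) ((z i)^-1 - (z l)^-1) = 0 by rewrite mulr0 mul0r.
  by apply/eqP; rewrite prodf_seq_eq0; apply/hasP; exists i; rewrite ?sE//= subrr.
rewrite addr0 => /eqP; rewrite !mulf_eq0 (negbTE (w0 _ _)) orbF.
case/orP => [/eqP//|]; rewrite prodf_seq_eq0 => /hasP[l]; rewrite sE => lk /=.
by rewrite subr_eq0 => /eqP/invr_inj/z_inj e; rewrite e eqxx in lk.
Qed.

(** Here [f j] is the tail of index [j].  All terms of the decomposition are nonnegative, so a null vector [x] is
    orthogonal to each of the rank one terms, and [orthogonal_shift] applies. *)
Lemma pick_strict n (z x : 'I_n -> C) (f : nat -> 'I_n -> C) (a : nat -> C) :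
  (forall i j, z i - (z j)^* != 0) -> injective z -> (forall j, 0 < a j) ->
  (forall j i, f j i * (1 - z i * f j.+1 i) = a j) ->
  (forall j, psd (pick_kernel z (f j))) ->
  (forall j, psd (pick_kernel z (fun i => z i * f j i))) ->
  qform (pick_kernel z (fun i => z i * f 0%N i)) x = 0 -> forall i, x i = 0.
Proof.
move=> zz z_inj a_gt0 rel psdK psdL Q0.
have a0 j : a j != 0 by exact: lt0r_neq0.
have ar j : a j \is Num.real by exact: gtr0_real.
have z0 i : z i != 0.
  by apply: contraNneq (zz i i) => ->; rewrite conjC0 subr0.
have f0 j i : f j i != 0.
  by have := a0 j; rewrite -(rel j i); apply: contraNneq => ->; rewrite mul0r.
have inv1 j i : f j i / a j * (1 - z i * f j.+1 i) = 1.
  by rewrite mulrAC rel divff.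
(* The products of the factors collected by the form after 2 j levels. *)
pose c := fix c j i := if j is j'.+1 then
  c j' i * (f j'.*2 i / a j'.*2) * z i * (f j'.*2.+1 i / a j'.*2.+1) else 1.
have c0 j i : c j i != 0.
  by elim: j => [|j IH] /=; rewrite ?oner_neq0// !mulf_neq0 ?invr_eq0.
pose w j i := c j i * (f j.*2 i / a j.*2).
pose v j i := w j i * (f j.*2.+1 i / a j.*2.+1).
have cS j i : c j.+1 i = v j i * z i by rewrite /v /w /=; ring.
have main j : qform (pick_kernel z (fun i => z i * f j.*2 i)) (fun i => x i * c j i) = 0
   /\ \sum_i x i * w j i = 0.
  have split2 m : qform (pick_kernel z (fun i => z i * f m.*2 i)) (fun i => x i * c m i) = 0 ->
     \sum_i x i * w m i = 0 /\
     qform (pick_kernel z (f m.*2.+1)) (fun i => x i * w m i * z i) = 0.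
    rewrite (qform_pickL zz (a0 _) (ar _) (rel m.*2)) => /eqP.
    rewrite mulf_eq0 (negbTE (a0 _)) /= paddr_eq0 ?exprn_ge0//; last exact: psdK.
    rewrite expf_eq0 /= normr_eq0 => /andP[/eqP e1 /eqP e2]; split.
      by rewrite -[RHS]e1; apply: eq_bigr => i _; rewrite /w mulrA.
    by rewrite -[RHS]e2; apply: qform_ext => i /=; rewrite /w; ring.
  elim: j => [|j [/split2[_ IH] _]].
    have H : qform (pick_kernel z (fun i => z i * f 0%N i)) (fun i => x i * c 0%N i) = 0.
      by rewrite -[RHS]Q0; apply: qform_ext => i; rewrite mulr1.
    by split; [exact: H|exact: (split2 0%N H).1].
  have H : qform (pick_kernel z (fun i => z i * f j.+1.*2 i)) (fun i => x i * c j.+1 i) = 0.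
    move: IH; rewrite (qform_pickK (a0 _) (ar _) (rel j.*2.+1)) => /eqP.
    rewrite mulf_eq0 (negbTE (a0 _)) /= => /eqP e; rewrite -[RHS]e.
    by apply: qform_ext => i /=; rewrite -/(c j.+1 i) cS /v; ring.
  by split; [exact: H|exact: (split2 _ H).1].
apply: (@orthogonal_shift n z x w v (fun j => a j.+1.*2) (fun j => a j.+1.*2.+1)).
- exact: z_inj.
- by move=> j i; rewrite /w !mulf_neq0 ?invr_eq0.
- move=> j i; rewrite {2}/w cS.
  have -> : w j i = v j i * (1 - z i * f j.*2.+2 i).
    by rewrite /v -mulrA inv1 mulr1.
  by rewrite doubleS; field; exact: a0.
- move=> j i.
  have e : w j.+1 i * (1 - z i * f j.+1.*2.+1 i) = v j i * z i.
    by rewrite {1}/w -mulrA inv1 mulr1 cS.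
  apply: (mulIf (z0 i)); rewrite divfK// mulrDl -e /v.
  by field; exact: a0.
- by move=> j; exact: (main j).2.
Qed.

End Strictness.

(** * Numerators, denominators and the upper bound *)

Section Homogeneous.
Variables (R : realType) (alpha : nat -> R).
Local Notation C := (R[i]).
Local Notation a k := ((alpha k)%:C%C : C).
Local Notation t := (tail_lim alpha).

(** Numerator and denominator of the continued fraction with [d] levels above
    the tail of index [k + d]; unlike their quotient they have no poles. *)
Fixpoint numden (z : C) k d : C * C :=
  if d is d'.+1 then
    let: (p, q) := numden z k.+1 d' in (a k * q, q - z * p)
  else (t k z, 1).

Definition cfnum z k d := (numden z k d).1.
Definition cfden z k d := (numden z k d).2.

Lemma numS z k d : cfnum z k d.+1 = a k * cfden z k.+1 d.
Proof. by rewrite /cfnum /cfden /=; case: numden. Qed.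

Lemma denS z k d : cfden z k d.+1 = cfden z k.+1 d - z * cfnum z k.+1 d.
Proof. by rewrite /cfnum /cfden /=; case: numden. Qed.

(** The Pick kernel of [p / q], or of [z * p / q] if [b], multiplied by
    [q i * (q j)^*], which makes sense at the zeros of [q] as well. *)
Definition hkernel (b : bool) n (z p q : 'I_n -> C) (i j : 'I_n) : C :=
  let y i := (if b then z i else 1) * p i in
  (y i * (q j)^* - q i * (y j)^*) / (z i - (z j)^*).

(** The number of negative terms among the rank one kernels which are split off
    in [d] steps from [e] times the kernel of the tail of index [k] ([b = false]) or
    of [z] times this tail ([b = true]): the two kinds of kernels alternate, and
    only the second one splits off a term. *)
Fixpoint nneg (b : bool) (e : R) k d : nat :=
  if d is d'.+1 then
    ((b && (e * alpha k < 0)%R) + nneg (~~ b) (e * alpha k)%R k.+1 d')%N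
  else 0%N.

Section Points.
Variables (n : nat) (z : 'I_n -> C).
Hypothesis zz : forall i j, z i - (z j)^* != 0.

Local Notation H b k d := (hkernel b z (fun i => cfnum (z i) k d) (fun i => cfden (z i) k d)).

Lemma qform_hkernelK k d x : qform (H false k d.+1) x = a k * qform (H true k.+1 d) x.
Proof.
rewrite -qformZ; apply: eq_qform => i j.
rewrite /hkernel /= !denS !numS !mul1r !(rmorphM, rmorphB) /= conj_realC.
by set D := (z i - _)^-1; ring.
Qed.

Lemma qform_hkernelL k d x : qform (H true k d.+1) x =
  a k * (`|\sum_i x i * cfden (z i) k.+1 d| ^+ 2 +
         qform (H false k.+1 d) (fun i => x i * z i)).
Proof.
rewrite -qform_rank1 -qform_congr -qformD -qformZ; apply: eq_qform => i j.
rewrite /hkernel /= !denS !numS !mul1r !(rmorphM, rmorphB) /= conj_realC.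
have := zz i j; set D := z i - _ => D0.
have -> : (z j)^* = z i - D by rewrite /D; ring.
by field.
Qed.

(** The functionals [V] are the split off rank one terms with a negative
    coefficient; on their common kernel the others can only increase the form. *)
Lemma hkernel_lower d k b (e : R) : (forall i, alpha i != 0) ->
  exists (V : nat -> 'I_n -> C) (G : 'I_n -> C), (forall i, G i != 0) /\
  forall x, (forall l, (l < nneg b e k d)%N -> \sum_i x i * V l i = 0) ->
  (e * \prod_(k <= i < k + d) alpha i)%:C%C *
    qform (H (b (+) odd d) (k + d) 0) (fun i => x i * G i)
  <= e%:C%C * qform (H b k d) x.
Proof.
move=> alpha0.
have z0 i : z i != 0.
  by apply: contraNneq (zz i i) => ->; rewrite conjC0 subr0.
elim: d k b e => [|d IH] k b e.
  exists (fun=> fun=> 0), (fun=> 1); split=> [i|x _]; first exact: oner_neq0.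
  rewrite addbF addn0 big_geq// mulr1; under qform_ext do rewrite mulr1.
  by [].
have [V [G [G0 HV]]] := IH k.+1 (~~ b) (e * alpha k).
have -> : e * \prod_(k <= i < k + d.+1) alpha i =
  e * alpha k * \prod_(k.+1 <= i < k.+1 + d) alpha i.
  by rewrite addnS -addSn big_ltn ?mulrA// addSn ltnS leq_addr.
have -> : b (+) odd d.+1 = ~~ b (+) odd d by rewrite /= addbN addNb.
rewrite addnS -addSn; case: b V HV => /= V HV; last first.
  exists V, G; split=> // x xV; rewrite qform_hkernelK.
  by apply: le_trans (HV x xV) _; rewrite mulrA rmorphM.
exists (fun l i => if (e * alpha k < 0) then
    (if l is l'.+1 then z i * V l' i else cfden (z i) k.+1 d) else z i * V l i),
  (fun i => z i * G i); split=> [i|x xV]; first by rewrite mulf_neq0.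
rewrite qform_hkernelL mulrA -rmorphM.
have -> : qform (H (odd d) (k.+1 + d) 0) (fun i => x i * (z i * G i)) =
   qform (H (odd d) (k.+1 + d) 0) (fun i => x i * z i * G i).
  by apply: qform_ext => i; rewrite mulrA.
apply: le_trans (HV _ _) _ => [l lV|].
  case: (ltP (e * alpha k) 0) xV => ea xV.
    by rewrite -[RHS](xV l.+1); [apply: eq_bigr => i _; rewrite mulrA|rewrite add1n].
  by rewrite -[RHS](xV l); [apply: eq_bigr => i _; rewrite mulrA|rewrite add0n].
rewrite mulrDr lerDr; case: (ltP (e * alpha k) 0) xV => ea xV.
  by rewrite (xV 0%N) ?add1n// normr0 expr0n mulr0.
by rewrite mulr_ge0 ?exprn_ge0// ler0c.
Qed.

End Points.
End Homogeneous.

(** * Poles of the continuation *)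

Section ComplexPoints.
Variable R : realType.
Local Notation C := (R[i]).

Lemma nonreal_near (a : C) : nonreal a -> \forall z \near (a : R[i]^o), nonreal z.
Proof.
rewrite /nonreal /= -sub_conj_neq0 => aa.
have aF : (fun z : C => z : R[i]^o) @ (a : R[i]^o) --> (a : R[i]^o).
  exact: ccvg_id.
have : \forall z \near (a : R[i]^o), z - z^* != 0.
  exact: (ccvg_neq0 aa (ccvgB aF (ccvg_conj aF))).
by apply: filterS => z; rewrite sub_conj_neq0.
Qed.

(** Used to see that points near 0 are admissible. *)
Lemma bounded_not_pole (f : C -> C) (a M : C) :
  (\forall z \near (a : R[i]^o)^', `|f z| <= M) -> ~ pole f a.
Proof.
move=> fM [_ /(_ [set x | M < x])] H.
have [|z [zM Mz]] := filter_ex (filterI fM (H _)).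
  exists `|M|; split; first exact: normr_real.
  move=> x Mx /=; apply: le_lt_trans Mx.
  have [z Mz] := filter_ex fM.
  by rewrite real_ler_norm// ger0_real// (le_trans _ Mz).
by have := lt_le_trans Mz zM; rewrite ltxx.
Qed.

Section Quotient.
Variables p q : C -> C.
Hypothesis p_der : forall a, nonreal a -> derivable (p : R[i]^o -> R[i]^o) a 1.
Hypothesis q_der : forall a, nonreal a -> derivable (q : R[i]^o -> R[i]^o) a 1.
Hypothesis pq_neq0 : forall a, nonreal a -> q a = 0 -> p a != 0.
Hypothesis q_isolated : forall a, nonreal a ->
  \forall z \near (a : R[i]^o)^', q z != 0.

Lemma quotient_pole a : nonreal a -> q a = 0 -> pole (fun z => p z / q z) a.
Proof.
move=> aN qa; split.
  apply: filterS (filterI (dnbhs_nbhs (nonreal_near aN)) (q_isolated aN)) => z [zN qz].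
  exact: (cderivableM (p_der zN) (cderivableV qz (q_der zN))).
move=> P [M [Mr MP]].
have pa := pq_neq0 aN qa.
have cp := cderivable_cvg (p_der aN).
have cq := cderivable_cvg (q_der aN).
have c0 : (fun z => q z * (p z)^-1 : R[i]^o) @ (a : R[i]^o) --> (0 : R[i]^o).
  by apply: (ccvg_eq (ccvgM cq (ccvgV pa cp))); rewrite qa mul0r.
have M1 : 0 < `|M| + 1 by rewrite ltr_wpDl.
have iM1 : 0 < (`|M| + 1)^-1 by rewrite invr_gt0.
have n1 : \forall z \near (a : R[i]^o), `|0 - q z * (p z)^-1| < (`|M| + 1)^-1.
  exact: (ccvg_near c0 iM1).
have n2 : \forall z \near (a : R[i]^o), p z != 0 by exact: (ccvg_neq0 pa cp).
suff : \forall z \near (a : R[i]^o)^', P `|p z / q z| by [].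
apply: filterS (filterI (dnbhs_nbhs (filterI n1 n2)) (q_isolated aN)) => z [[]].
rewrite sub0r normrN => H pz qz; apply: MP.
have qp0 : q z * (p z)^-1 != 0 by rewrite mulf_neq0 ?invr_eq0.
have -> : p z / q z = (q z * (p z)^-1)^-1 by rewrite invfM invrK mulrC.
apply: (@lt_le_trans _ _ (`|M| + 1)).
  by apply: le_lt_trans (real_ler_norm Mr) _; rewrite ltrDl.
by rewrite normfV -[X in X <= _]invrK lef_pV2 ?ltW// posrE// normr_gt0.
Qed.

Lemma quotient_meromorphic : meromorphic_on (@nonreal R) (fun z => p z / q z).
Proof.
move=> a aN; have [qa|qa] := eqVneq (q a) 0; [right; exact: quotient_pole|left].
have q0 : \forall z \near (a : R[i]^o), q z != 0.
  exact: (ccvg_neq0 qa (cderivable_cvg (q_der aN))).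
apply: filterS (filterI (nonreal_near aN) q0) => z [zN qz].
exact: (cderivableM (p_der zN) (cderivableV qz (q_der zN))).
Qed.

End Quotient.

Lemma meromorphic_upper (f : C -> C) : meromorphic_on (@nonreal R) f ->
  meromorphic_on (@upper_half R) f.
Proof. by move=> H a /upper_nonreal; exact: H. Qed.

Lemma pick_matrix_herm (f : C -> C) n (z : 'I_n -> C) :
  pick_matrix f z \is hermsymmx.
Proof.
apply/is_hermitianmxP; rewrite expr0 scale1r; apply/matrixP => i j.
by rewrite !mxE; apply/esym; exact: pick_herm.
Qed.

End ComplexPoints.

Section Continuation.
Variables (R : realType) (alpha : nat -> R) (E : nat) (A : R).
Local Notation C := (R[i]).
Hypothesis alpha_neq0 : forall k, alpha k != 0.
Hypothesis alpha_pos : forall k, (E <= k)%N -> 0 < alpha k.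
Hypothesis alpha_le : forall k, `|alpha k| <= A.
Local Notation num := (cfnum alpha).
Local Notation den := (cfden alpha).
Local Notation t := (tail_lim alpha).

Lemma numden_derivable d k a : nonreal a -> (k + d = E)%N ->
  derivable ((fun z => num z k d) : R[i]^o -> R[i]^o) a 1 /\
  derivable ((fun z => den z k d) : R[i]^o -> R[i]^o) a 1.
Proof.
move=> aN; elim: d k => [|d IH] k kE.
  split; last exact: cderivable_cst.
  apply: (tail_lim_derivable alpha_pos alpha_le).
    by rewrite sub_conj_neq0.
  by rewrite -kE addn0.
have [|dp dq] := IH k.+1; first by rewrite addSn -addnS.
split.
  have -> : (fun z => num z k d.+1) = (fun z => (alpha k)%:C%C * den z k.+1 d).
    by apply/funext => z; rewrite numS.
  exact: (cderivableM (@cderivable_cst R _ _) dq).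
have -> : (fun z => den z k d.+1) = (fun z => den z k.+1 d - z * num z k.+1 d).
  by apply/funext => z; rewrite denS.
exact: (cderivableB dq (cderivableM (@cderivable_id R _) dp)).
Qed.

(** A common zero would propagate to the innermost denominator, which is 1. *)
Lemma num_neq0 d k z : z != 0 -> den z k d = 0 -> num z k d != 0.
Proof.
move=> z0; elim: d k => [|d IH] k; first by move/eqP; rewrite oner_eq0.
rewrite denS numS => /eqP; rewrite subr_eq0 => /eqP e.
rewrite mulf_neq0 ?realC_neq0//; apply/negP => /eqP d0.
move: (e); rewrite d0 => /esym/eqP; rewrite mulf_eq0 (negbTE z0) /=.
by rewrite (negbTE (IH _ d0)).
Qed.

Lemma numden_conj d k z : nonreal z -> (k + d = E)%N ->
  num z^* k d = (num z k d)^* /\ den z^* k d = (den z k d)^*.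
Proof.
move=> zN; elim: d k => [|d IH] k kE.
  split; last by rewrite /cfden /= rmorph1.
  apply: (tail_lim_conj alpha_pos alpha_le); first by rewrite sub_conj_neq0.
  by rewrite -kE addn0.
have [|ep eq] := IH k.+1; first by rewrite addSn -addnS.
by rewrite !numS !denS ep eq !(rmorphM, rmorphB) /= conj_realC.
Qed.

Lemma hkernel_psd n (z : 'I_n -> C) b : (forall i j, z i - (z j)^* != 0) ->
  psd (hkernel b z (fun i => num (z i) E 0) (fun i => den (z i) E 0)).
Proof.
move=> zz x; rewrite (@eq_qform _ _ _
  (pick_kernel z (fun i => (if b then z i else 1) * t E (z i)))); last first.
  by move=> i j; rewrite /hkernel /cfden /= rmorph1 mulr1 mul1r.
case: b; first exact: (tail_lim_psdL alpha_pos alpha_le zz (leqnn E)).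
have := tail_lim_psdK alpha_pos alpha_le zz (leqnn E) x.
by congr (0 <= _); apply: eq_qform => i j; rewrite /pick_kernel !mul1r.
Qed.

Variable e : R.
Hypothesis e_pos : 0 < e * \prod_(0 <= i < E) alpha i.

(** At zeros of the denominator the form of [hkernel_lower] vanishes.  With
    more than [nneg] zeros there would be a nonzero vector in the kernel of the
    functionals, and it would be a null vector of the strictly positive form of the
    tail. *)
Lemma den_zeros n (z : 'I_n -> C) : odd E -> (forall i j, z i - (z j)^* != 0) ->
  injective z -> (forall i, den (z i) 0 E = 0) -> (n <= nneg alpha false e 0 E)%N.
Proof.
move=> oE zz z_inj z0; rewrite leqNgt; apply/negP => lt.
have [V [G [G0 HV]]] := hkernel_lower zz E 0 false e alpha_neq0.
have [|x [[i0 xi0] xV]] := @exists_common_kernel C n 'I_(nneg alpha false e 0 E)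
  (fun l => V l); first by rewrite card_ord.
have := HV x (fun l lV => xV (Ordinal lV)).
rewrite add0n oE /= [X in _ <= _ * X](_ : _ = 0); last first.
  rewrite (@eq_qform _ _ _ (fun=> fun=> 0 * 0)) ?qformZ ?mul0r// => i j.
  by rewrite /hkernel !z0 conjC0 mulr0 mul0r subrr !mul0r.
rewrite mulr0 pmulr_rle0 ?realC_gt0// => Q0.
have {}Q0 : qform (pick_kernel z (fun i => z i * t E (z i))) (fun i => x i * G i) = 0.
  apply/eqP; rewrite eq_le (tail_lim_psdL alpha_pos alpha_le zz (leqnn E)) andbT.
  rewrite (le_trans _ Q0)// le_eqVlt; apply/orP; left; apply/eqP.
  by apply: eq_qform => i j; rewrite /hkernel /cfden /= rmorph1 mulr1 mul1r.
have := @pick_strict C n z (fun i => x i * G i) (fun j i => t (E + j) (z i))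
  (fun j => (alpha (E + j))%:C%C) zz z_inj.
have EE j : (E <= E + j)%N by exact: leq_addr.
rewrite addn0 => /(_ _ _ _ _ Q0) H.
have : x i0 * G i0 = 0.
  apply: H => j *.
  - by rewrite realC_gt0 alpha_pos.
  - by rewrite addnS (tail_lim_rel alpha_pos alpha_le).
  - exact: (tail_lim_psdK alpha_pos alpha_le zz (EE j)).
  - exact: (tail_lim_psdL alpha_pos alpha_le zz (EE j)).
by move/eqP; rewrite mulf_eq0 (negbTE xi0) (negbTE (G0 _)).
Qed.

(** Accumulating zeros would provide arbitrarily many distinct ones so close to
    [a] that they all lie in the half-plane of [a]. *)
Lemma den_isolated a : odd E -> nonreal a ->
  \forall z \near (a : R[i]^o)^', den z 0 E != 0.
Proof.
move=> oE aN; apply: contrapT => H.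
have aa : a - a^* != 0 by rewrite sub_conj_neq0.
(* Within this distance of a, differences z - conj(w) stay away from 0. *)
pose r := `|a - a^*| / 2.
have r0 : 0 < r by rewrite divr_gt0 ?normr_gt0.
have pick_zero (U : set C) : (\forall z \near (a : R[i]^o), U z) ->
    exists z, [/\ U z, z != a & den z 0 E = 0].
  move=> aU; apply: contrapT => H'; apply: H.
  rewrite near_withinE; apply: filterS aU => z Uz za.
  by apply/eqP => z0; apply: H'; exists z.
have : forall n, exists s : seq C, [/\ size s = n, uniq s &
    forall z, z \in s -> [/\ `|a - z| < r, z != a & den z 0 E = 0]].
  elim=> [|n [s [sn us sP]]]; first by exists [::].
  have U1 : \forall z \near (a : R[i]^o), `|a - z| < r.
    exact: (ccvg_near (@ccvg_id R a) r0).
  have U2 : \forall z \near (a : R[i]^o), z \notin s.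
    have : forall x, x \in s -> x != a by move=> x /sP[].
    elim: (s) => [_|x s' IH sa]; first exact: filterE.
    have ax : a - x != 0 by rewrite subr_eq0 eq_sym sa ?mem_head.
    have N1 : \forall z \near (a : R[i]^o), z - x != 0.
      exact: (ccvg_neq0 ax (ccvgB (@ccvg_id R a) (ccvg_cst x))).
    have N2 := IH (fun y ys => sa y (mem_behead (s := x :: s') ys)).
    apply: filterS (filterI N1 N2) => z [zx zs].
    by rewrite inE negb_or -subr_eq0 zx zs.
  have [z [[z1 z2] za z0]] := pick_zero _ (filterI U1 U2).
  exists (z :: s); split; [by rewrite /= sn|by rewrite /= z2|].
  by move=> y; rewrite inE => /orP[/eqP->|/sP].
move=> /(_ (nneg alpha false e 0 E).+1)[s [sn us sP]].
set m := (nneg alpha false e 0 E).+1 in sn.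
have sm (i : 'I_m) : nth 0 s i \in s by rewrite mem_nth// sn.
suff : (m <= nneg alpha false e 0 E)%N by rewrite ltnn.
apply: (@den_zeros m (fun i => nth 0 s i)) => //.
- move=> i j; have [[zi _ _] [zj _ _]] := (sP _ (sm i), sP _ (sm j)).
  have : `|(a - nth 0 s i) - (a - nth 0 s j)^*| < `|a - a^*|.
    apply: le_lt_trans (ler_normB _ _) _; rewrite norm_conjC.
    by rewrite [X in _ < X](splitr `|a - a^*|) ltrD.
  apply: contraTneq => sij; rewrite rmorphB /=.
  have -> : a - nth 0 s i - (a^* - (nth 0 s j)^*) =
    a - a^* - (nth 0 s i - (nth 0 s j)^*) by ring.
  by rewrite sij subr0 ltxx.
- move=> i j /eqP; rewrite nth_uniq ?sn// => /eqP; exact: val_inj.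
- by move=> i; have [] := sP _ (sm i).
Qed.

End Continuation.

(** * Convergence of all tails near zero *)

Section NearZero.
Variables (R : realType) (alpha : nat -> R) (A : R).
Local Notation C := (R[i]).
Hypothesis A_gt0 : 0 < A.
Hypothesis alpha_le : forall k, `|alpha k| <= A.
Local Notation t := (tail_lim alpha).
Local Notation AC := (A%:C%C : C).

(** In this disc every denominator has modulus at least 1/2, so that every
    tail has modulus at most [2 A], and one level of the continued fraction
    contracts distances by the factor [4 A |z| <= 1 / 2]. *)
Definition small (z : C) := `|z| * (8 * AC) <= 1.

Lemma AC_gt0 : 0 < AC. Proof. by rewrite realC_gt0. Qed.

Lemma norm_alphaC k : `|(alpha k)%:C%C : C| <= AC.
Proof. by rewrite normc_def /= expr0n addr0 sqrtr_sqr lecR. Qed.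

Lemma small_denom z g : small z -> `|g| <= 2 * AC -> 2^-1 <= `|1 - z * g|.
Proof.
move=> zs gA.
have zg : `|z * g| <= 2^-1.
  rewrite -(ler_pM2l (ltr0n _ 4 : 0 < 4%:R)).
  have -> : 4%:R * 2^-1 = 2 :> C by field.
  rewrite normrM; apply: (@le_trans _ _ (4%:R * (`|z| * (2 * AC)))).
    by rewrite ler_pM2l ?ltr0n// ler_wpM2l.
  have -> : 4%:R * (`|z| * (2 * AC)) = `|z| * (8 * AC) by ring.
  by apply: le_trans zs _; rewrite ler1n.
have := lerB_dist 1 (z * g); rewrite normr1; apply: le_trans.
rewrite -[X in X <= _](_ : 1 - 2^-1 = _); last by field.
by rewrite lerB.
Qed.

Lemma small_step z g k : small z -> `|g| <= 2 * AC ->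
  `|(alpha k)%:C%C / (1 - z * g)| <= 2 * AC.
Proof.
move=> zs gA; have d := small_denom zs gA.
have d0 : 0 < `|1 - z * g| by apply: lt_le_trans d; rewrite invr_gt0.
rewrite normrM normfV ler_pdivrMr//; apply: le_trans (norm_alphaC k) _.
have -> : 2 * AC * `|1 - z * g| = AC * (2 * `|1 - z * g|) by ring.
rewrite ler_peMr ?(ltW AC_gt0)//.
by rewrite -[X in X <= _](_ : 2 * 2^-1 = _) ?ler_pM2l// mulfV.
Qed.

Lemma small_tail_le z k d : small z -> `|cfrac_tail alpha z k d| <= 2 * AC.
Proof.
move=> zs; elim: d k => [|d IH] k /=; last exact: small_step.
by apply: le_trans (norm_alphaC k) _; rewrite ler_peMl ?(ltW AC_gt0)// ler1n.
Qed.

Lemma small_tail_cauchy z i n m k : small z -> (i <= n)%N -> (i <= m)%N ->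
  2 ^+ i * `|cfrac_tail alpha z k n - cfrac_tail alpha z k m| <= 4 * AC.
Proof.
move=> zs; elim: i n m k => [|i IH] n m k.
  move=> _ _; rewrite expr0 mul1r; apply: le_trans (ler_normB _ _) _.
  have -> : 4 * AC = 2 * AC + 2 * AC by ring.
  by rewrite lerD ?small_tail_le.
case: n => [//|n]; case: m => [//|m]; rewrite !ltnS => ni mi /=.
set g := cfrac_tail _ _ _ n; set h := cfrac_tail _ _ _ m.
have gA : `|g| <= 2 * AC by exact: small_tail_le.
have hA : `|h| <= 2 * AC by exact: small_tail_le.
have [dg dh] := (small_denom zs gA, small_denom zs hA).
have dg0 : 0 < `|1 - z * g| by apply: lt_le_trans dg; rewrite invr_gt0.
have dh0 : 0 < `|1 - z * h| by apply: lt_le_trans dh; rewrite invr_gt0.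
have -> : (alpha k)%:C%C / (1 - z * g) - (alpha k)%:C%C / (1 - z * h) =
   (alpha k)%:C%C * z * (g - h) / ((1 - z * g) * (1 - z * h)).
  field; by rewrite -!normr_gt0 dg0 dh0.
have H : 2 ^+ i * `|g - h| <= 4 * AC by exact: IH.
apply: le_trans H; rewrite exprSr -mulrA; apply: ler_wpM2l; first exact: exprn_ge0.
rewrite normrM normfV [`|_ * (1 - z * h)|]normrM mulrA ler_pdivrMr ?mulr_gt0//.
have Q : 4^-1 <= `|1 - z * g| * `|1 - z * h|.
  have -> : 4^-1 = 2^-1 * 2^-1 :> C by field.
  by apply: ler_pM.
apply: (@le_trans _ _ (`|g - h| * 4^-1)); last exact: ler_wpM2l.
rewrite !normrM mulrA [X in X <= _]mulrC; apply: ler_wpM2l => //.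
rewrite -(ler_pM2r (ltr0n _ 4 : 0 < 4%:R)) mulVf//.
apply: le_trans zs.
have -> : 2 * (`|(alpha k)%:C%C| * `|z|) * 4 = `|z| * (8 * `|(alpha k)%:C%C|) :> C by ring.
by rewrite ler_wpM2l// ler_wpM2l// norm_alphaC.
Qed.

Lemma small_tail_cvg z k : small z ->
  (cfrac_tail alpha z k n : R[i]^o) @[n --> \oo] --> (t k z : R[i]^o).
Proof.
move=> zs; apply: (@cvgn_harmonic _ (cfrac_tail alpha z k) (4 * A)) => i n m ni mi.
have ii : (i <= i.*2)%N by rewrite -addnn leq_addr.
have := small_tail_cauchy k zs (leq_trans ii ni) (leq_trans ii mi).
rewrite rmorphM rmorph_nat; apply: le_trans; apply: ler_wpM2r => //.
by rewrite -natrX ler_nat ltnW// ltn_expl.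
Qed.

Lemma small_tail_lim_le z k : small z -> `|t k z| <= 2 * AC.
Proof.
move=> zs; have c := @small_tail_cvg z k zs.
rewrite real_leNgt ?normr_real ?ger0_real ?mulr_ge0 ?(ltW AC_gt0)//.
apply/negP => lt; have e0 : 0 < `|t k z| - 2 * AC by rewrite subr_gt0.
have [n H] := filter_ex (ccvg_near c e0).
have := lerB_dist (t k z) (cfrac_tail alpha z k n).
move=> /le_lt_trans/(_ H); rewrite ltrD2l ltrN2.
by move=> /lt_le_trans/(_ (small_tail_le k n zs)); rewrite ltxx.
Qed.

Lemma small_tail_lim_rel z k : small z ->
  t k z * (1 - z * t k.+1 z) = (alpha k)%:C%C.
Proof.
move=> zs.
have c1 := @small_tail_cvg z k zs.
have c2 : (fun n => cfrac_tail alpha z k n.+1 : R[i]^o) @ \oo --> (t k z : R[i]^o).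
  by rewrite -cvg_shiftS in c1.
have c3 : (fun n => cfrac_tail alpha z k n.+1 *
    (1 - z * cfrac_tail alpha z k.+1 n) : R[i]^o) @ \oo -->
    (t k z * (1 - z * t k.+1 z) : R[i]^o).
  exact: (ccvgM c2 (ccvgB (ccvg_cst 1) (ccvgM (ccvg_cst z) (@small_tail_cvg z k.+1 zs)))).
apply: (ccvg_unique _ c3).
have -> : (fun n => cfrac_tail alpha z k n.+1 * (1 - z * cfrac_tail alpha z k.+1 n))
    = (fun=> (alpha k)%:C%C).
  apply/funext => n /=; rewrite divfK//.
  have := small_denom zs (small_tail_le k.+1 n zs); apply: contraTneq => ->.
  by rewrite normr0; apply/negP => /le_gtF; rewrite invr_gt0 ltr0n.
exact: ccvg_cst.
Qed.

Lemma small_near : \forall z \near (0 : R[i]^o), small z.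
Proof.
have e0 : 0 < (8 * AC)^-1 by rewrite invr_gt0 mulr_gt0 ?AC_gt0.
apply: filterS (ccvg_near (@ccvg_id R 0) e0) => z.
rewrite sub0r normrN /small => /ltW.
by rewrite -[(8 * AC)^-1]mul1r ler_pdivlMr// mulr_gt0 ?AC_gt0.
Qed.

Hypothesis alpha_neq0 : forall k, alpha k != 0.

Lemma small_tail_lim_neq0 z k : small z -> t k z != 0.
Proof.
move=> zs; have := realC_neq0 (alpha_neq0 k).
by rewrite -(small_tail_lim_rel k zs); apply: contraNneq => ->; rewrite mul0r.
Qed.

Lemma small_numden z k d : small z ->
  cfden alpha z k d != 0 /\ cfnum alpha z k d = t k z * cfden alpha z k d.
Proof.
move=> zs; elim: d k => [|d IH] k; first by rewrite /cfden /cfnum /= oner_neq0 mulr1.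
have [d0 e] := IH k.+1; rewrite denS numS e.
have -> : cfden alpha z k.+1 d - z * (t k.+1 z * cfden alpha z k.+1 d) =
  (1 - z * t k.+1 z) * cfden alpha z k.+1 d by ring.
have rel := small_tail_lim_rel k zs; split; last by rewrite mulrA rel.
rewrite mulf_neq0//; have := realC_neq0 (alpha_neq0 k).
by rewrite -rel; apply: contraNneq => ->; rewrite mulr0.
Qed.

End NearZero.

(** * Negative subspaces near zero *)

Section LinearFunctionals.
Variable C : numClosedFieldType.
Implicit Types (y u : nat -> C) (phi psi : (nat -> C) -> C).

(** A linear functional of the first [r] coordinates; indexing the coordinates
    by [nat] makes it easy to prepend one. *)
Definition linfunc r phi := exists u, forall y, phi y = \sum_(l < r) y l * u l.

Definition sumsq r y : C := \sum_(l < r) `|y l| ^+ 2.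

Lemma sumsq_ge0 r y : 0 <= sumsq r y.
Proof. by apply: sumr_ge0 => l _; rewrite exprn_ge0. Qed.

Lemma linfuncD r phi psi : linfunc r phi -> linfunc r psi ->
  linfunc r (fun y => phi y + psi y).
Proof.
move=> [u phiE] [v psiE]; exists (fun l => u l + v l) => y.
by rewrite phiE psiE -big_split; apply: eq_bigr => l _; rewrite mulrDr.
Qed.

Lemma linfuncZ r c phi : linfunc r phi -> linfunc r (fun y => c * phi y).
Proof.
move=> [u phiE]; exists (fun l => c * u l) => y.
by rewrite phiE mulr_sumr; apply: eq_bigr => l _; rewrite mulrCA.
Qed.

Lemma linfunc0 r : linfunc r (fun=> 0).
Proof. by exists (fun=> 0) => y; rewrite big1// => l _; rewrite mulr0. Qed.

Lemma linfunc_sum r n (phi : 'I_n -> (nat -> C) -> C) :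
  (forall i, linfunc r (phi i)) -> linfunc r (fun y => \sum_i phi i y).
Proof.
move=> H; have [u uE] := choice H; exists (fun l => \sum_i u i l) => y.
under eq_bigr do rewrite uE.
by rewrite exchange_big; apply: eq_bigr => l _; rewrite mulr_sumr.
Qed.

Lemma linfunc_head r : linfunc r.+1 (fun y => y 0%N).
Proof.
exists (fun l => (l == 0%N)%:R) => y; rewrite big_ord_recl mulr1 big1 ?addr0// => l _.
by rewrite mulr0.
Qed.

Lemma linfunc_behead r phi : linfunc r phi ->
  linfunc r.+1 (fun y => phi (fun l => y l.+1)).
Proof.
move=> [u phiE]; exists (fun l => if l is l'.+1 then u l' else 0) => y.
by rewrite big_ord_recl mulr0 add0r phiE.
Qed.

Lemma sqr_normD (a b : C) : `|a + b| ^+ 2 <= (`|a| ^+ 2 + `|b| ^+ 2) *+ 2.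
Proof.
apply: (@le_trans _ _ ((`|a| + `|b|) ^+ 2)).
  by rewrite ler_pXn2r ?nnegrE ?addr_ge0// ler_normD.
have H : 0 <= (`|a| - `|b|) ^+ 2.
  by rewrite real_exprn_even_ge0// realB// normr_real.
rewrite -subr_ge0 [X in 0 <= X](_ : _ = (`|a| - `|b|) ^+ 2)//; ring.
Qed.

Lemma linfunc_bound r phi : linfunc r phi ->
  exists2 M, 0 <= M & forall y, `|phi y| ^+ 2 <= M * sumsq r y.
Proof.
case=> u; elim: r phi => [|r IH] phi phiE.
  exists 0 => // y; by rewrite phiE big_ord0 normr0 expr0n mul0r.
have [M M0 HM] := IH (fun y => \sum_(l < r) y l * u l) (fun y => erefl).
exists ((M + `|u r| ^+ 2) *+ 2); first by rewrite mulrn_wge0// addr_ge0 ?exprn_ge0.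
move=> y; rewrite phiE big_ord_recr /sumsq big_ord_recr /=.
apply: le_trans (sqr_normD _ _) _; rewrite mulrnAl lerMn2r /= mulrDl.
apply: lerD.
  by apply: le_trans (HM y) _; rewrite ler_wpM2l// lerDl exprn_ge0.
rewrite normrM exprMn mulrC ler_wpM2l ?exprn_ge0// lerDr; exact: sumsq_ge0.
Qed.

Definition fcons n (a : C) (x : 'I_n -> C) (i : 'I_n.+1) :=
  if unlift ord0 i is Some j then x j else a.

Lemma fcons0 n a (x : 'I_n -> C) : fcons a x ord0 = a.
Proof. by rewrite /fcons unlift_none. Qed.

Lemma fconsS n a (x : 'I_n -> C) i : fcons a x (lift ord0 i) = x i.
Proof. by rewrite /fcons liftK. Qed.

Lemma qform_fcons n (k : 'I_n.+1 -> 'I_n.+1 -> C) a x :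
  qform k (fcons a x) =
  qform (fun i j => k (lift ord0 i) (lift ord0 j)) x +
  (\sum_j (a * (x j)^* * k ord0 (lift ord0 j) + x j * a^* * k (lift ord0 j) ord0) +
   a * a^* * k ord0 ord0).
Proof.
rewrite /qform big_ord_recl big_ord_recl !fcons0.
under eq_bigr do rewrite fconsS.
under [X in _ + _ + X = _]eq_bigr => i _ do
  (rewrite big_ord_recl fcons0 fconsS; under eq_bigr do rewrite fconsS).
rewrite big_split big_split /=; ring.
Qed.

Lemma qform_real n (k : 'I_n -> 'I_n -> C) x :
  (forall i j, (k i j)^* = k j i) -> qform k x \is Num.real.
Proof.
move=> kh; apply/CrealP; rewrite rmorph_sum /qform exchange_big.
apply: eq_bigr => i _ /=; rewrite rmorph_sum; apply: eq_bigr => j _ /=.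
by rewrite !rmorphM /= conjCK kh; ring.
Qed.

End LinearFunctionals.

Section AddPoint.
Variable R : realType.
Local Notation C := (R[i]).

Lemma norm_sub_conj_ge (z w : C) : upper_half z -> upper_half w ->
  (complex.Im z)%:C%C <= `|z - w^*| /\ (complex.Im w)%:C%C <= `|z - w^*|.
Proof.
rewrite /upper_half /= => z0 w0.
have := Im_le_norm (z - w^*); rewrite Im_sub_conj gtr0_norm ?addr_gt0// => H.
by split; apply: le_trans H; rewrite lecR ?lerDl ?lerDr ltW.
Qed.

(** When the new point [z0] tends to 0 with a coefficient proportional to
    [z0], its contribution to the form disappears: the kernel is bounded by a
    constant between [z0] and the old points and by [O(1 / |z0|)] at [z0] itself. *)
Lemma add_point n (z f : 'I_n -> C) (T : C) :
  (forall i, upper_half (z i)) -> (forall i, `|f i| <= T) -> 0 <= T ->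
  forall (delta : R) (z0 f0 omega : C) (xi : 'I_n -> C),
  0 < delta -> z0 = Complex 0 delta -> `|f0| <= T ->
  `|qform (pick_kernel (fcons z0 z) (fcons f0 f)) (fcons (z0 * omega) xi) -
    qform (pick_kernel z f) xi| <=
  delta%:C%C * (\sum_j (`|omega| ^+ 2 + `|xi j| ^+ 2) * (T *+ 2 / (complex.Im (z j))%:C%C)
    + `|omega| ^+ 2 * (T *+ 2)).
Proof.
move=> zU fT T0 delta z0 f0 omega xi d0 z0E f0T.
have z0U : upper_half z0 by rewrite z0E.
have dC : 0 <= (delta%:C%C : C) by rewrite ler0c ltW.
have nz0 : `|z0| = delta%:C%C.
  by rewrite z0E normc_def /= expr0n add0r sqrtr_sqr gtr0_norm.
have T2 a b : `|a| <= T -> `|b| <= T -> `|a - b^*| <= T *+ 2.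
  move=> aT bT; apply: le_trans (ler_normB _ _) _.
  by rewrite norm_conjC mulr2n lerD.
have TT : 0 <= T *+ 2 by rewrite mulrn_wge0.
have am (a b : C) : 0 <= a -> 0 <= b -> (a * b) *+ 2 <= a ^+ 2 + b ^+ 2.
  move=> a0 b0; rewrite -subr_ge0 [X in 0 <= X](_ : _ = (a - b) ^+ 2); last by ring.
  by rewrite real_exprn_even_ge0// realB// ger0_real.
rewrite qform_fcons.
rewrite [X in X + _ - _](@eq_qform _ _ _ (pick_kernel z f)); last first.
  by move=> i j; rewrite /pick_kernel !fconsS.
rewrite addrAC subrr add0r mulrDr mulr_sumr.
apply: le_trans (ler_normD _ _) _; apply: lerD; last first.
  rewrite /pick_kernel !fcons0 !normrM normfV norm_conjC normrM nz0.
  have [H _] := norm_sub_conj_ge z0U z0U.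
  have D0 : 0 < `|z0 - z0^*| by apply: lt_le_trans H; rewrite realC_gt0; exact: z0U.
  rewrite mulrA ler_pdivrMr//.
  have -> : delta%:C%C * `|omega| * (delta%:C%C * `|omega|) * `|f0 - f0^*| =
    (delta%:C%C * `|omega| ^+ 2) * (delta%:C%C * `|f0 - f0^*|) by ring.
  rewrite [X in _ <= X](_ : _ =
    (delta%:C%C * `|omega| ^+ 2) * (`|z0 - z0^*| * (T *+ 2))); last by ring.
  apply: ler_wpM2l; first by rewrite mulr_ge0// exprn_ge0.
  by apply: ler_pM => //; [move: H; rewrite {1}z0E|exact: T2].
apply: le_trans (ler_norm_sum _ _ _) _; apply: ler_sum => j _.
have wj : 0 < ((complex.Im (z j))%:C%C : C) by rewrite realC_gt0; exact: zU.
have bound (N : C) (D : C) : `|N| <= T *+ 2 -> (complex.Im (z j))%:C%C <= `|D| ->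
    `|N / D| <= T *+ 2 / (complex.Im (z j))%:C%C.
  move=> NT HD; rewrite normrM normfV; apply: ler_pM => //.
  by rewrite lef_pV2 ?posrE// (lt_le_trans wj).
have b1 : `|pick_kernel (fcons z0 z) (fcons f0 f) ord0 (lift ord0 j)| <=
    T *+ 2 / (complex.Im (z j))%:C%C.
  rewrite /pick_kernel !fcons0 !fconsS; apply: bound; first exact: T2.
  by have [] := norm_sub_conj_ge z0U (zU j).
have b2 : `|pick_kernel (fcons z0 z) (fcons f0 f) (lift ord0 j) ord0| <=
    T *+ 2 / (complex.Im (z j))%:C%C.
  rewrite /pick_kernel !fcons0 !fconsS; apply: bound; first exact: T2.
  by have [] := norm_sub_conj_ge (zU j) z0U.
have Q0 : 0 <= T *+ 2 / (complex.Im (z j))%:C%C by exact: le_trans b1.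
move: b1 b2 Q0; move: (_ / _) (pick_kernel _ _ ord0 _) (pick_kernel _ _ _ ord0).
move=> Q K1 K2 b1 b2 Q0; apply: le_trans (ler_normD _ _) _.
rewrite !normrM !norm_conjC normrM nz0.
apply: (@le_trans _ _ (delta%:C%C * ((`|omega| * `|xi j|) *+ 2 * Q))).
  rewrite [X in _ <= X](_ : _ = delta%:C%C * `|omega| * `|xi j| * Q +
     `|xi j| * (delta%:C%C * `|omega|) * Q); last by ring.
  by apply: lerD; (apply: ler_wpM2l; first by apply: mulr_ge0 => //; exact: mulr_ge0).
apply: ler_wpM2l => //; apply: ler_wpM2r => //; exact: am.
Qed.

End AddPoint.

Lemma error_bound (C : numClosedFieldType) n r (om : (nat -> C) -> C)
    (xi : (nat -> C) -> 'I_n -> C) (Q : 'I_n -> C) (P : C) :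
  linfunc r om -> (forall i, linfunc r (fun y => xi y i)) ->
  (forall i, 0 <= Q i) -> 0 <= P ->
  exists2 M, 0 <= M & forall y,
    \sum_j (`|om y| ^+ 2 + `|xi y j| ^+ 2) * Q j + `|om y| ^+ 2 * P <=
    M * sumsq r y.
Proof.
move=> /linfunc_bound[M0 M00 omM] xiL Q0 P0.
have /choice[M HM] : forall i, exists M, 0 <= M /\
    forall y, `|xi y i| ^+ 2 <= M * sumsq r y.
  by move=> i; have [M] := linfunc_bound (xiL i); exists M.
exists (\sum_j (M0 + M j) * Q j + M0 * P).
  rewrite addr_ge0 ?mulr_ge0// sumr_ge0// => j _.
  by rewrite mulr_ge0// addr_ge0// (HM j).1.
move=> y; rewrite mulrDl mulr_suml; apply: lerD; last first.
  by rewrite [X in _ <= X]mulrAC; apply: ler_wpM2r => //; exact: omM.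
apply: ler_sum => j _; rewrite [X in _ <= X]mulrAC; apply: ler_wpM2r => //.
by rewrite mulrDl; apply: lerD; [exact: omM|exact: (HM j).2].
Qed.

Section LowerBound.
Variables (R : realType) (alpha : nat -> R) (A : R).
Local Notation C := (R[i]).
Hypothesis A_gt0 : 0 < A.
Hypothesis alpha_le : forall k, `|alpha k| <= A.
Hypothesis alpha_neq0 : forall k, alpha k != 0.
Local Notation t := (tail_lim alpha).

Definition shift_kernel (b : bool) n (z f : 'I_n -> C) :=
  pick_kernel z (fun i => if b then z i * f i else f i).

(** The map [L] parametrizes an [r]-dimensional space of coefficient vectors
    on which [e] times the Pick form at suitable points is negative definite; the
    margin [c] makes the property stable under small perturbations. *)
Definition neg_subspace (b : bool) (e : R) (k r : nat) (rho : R) :=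
  exists n (z : 'I_n -> C) (L : (nat -> C) -> 'I_n -> C) (c : R),
  [/\ (0 < n)%N, 0 < c,
      forall i, [/\ upper_half (z i), `|z i| < rho%:C%C & small A (z i)],
      forall i, linfunc r (fun y => L y i)
    & forall y, e%:C%C * qform (shift_kernel b z (fun i => t k (z i))) (L y) <=
        - (c%:C%C * sumsq r y)].

Lemma small_imaginary (rho m : R) : 0 < rho -> 0 < m -> exists delta : R,
  [/\ 0 < delta, `|Complex 0 delta| < rho%:C%C :> C, small A (Complex 0 delta)
    & delta <= m].
Proof.
move=> rho0 m0.
pose delta := Num.min m (Num.min (rho / 2) (8 * A)^-1).
have A8 : 0 < 8 * A by rewrite mulr_gt0.
have d0 : 0 < delta by rewrite !lt_min m0 divr_gt0// invr_gt0 A8.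
have nd : `|Complex 0 delta| = delta%:C%C :> C.
  by rewrite normc_def /= expr0n add0r sqrtr_sqr gtr0_norm.
exists delta; split=> //.
- rewrite nd ltcR; apply: (@le_lt_trans _ _ (rho / 2)).
    by rewrite /delta !ge_min lexx orbT.
  by rewrite ltr_pdivrMr// ltr_pMr// ltr1n.
- rewrite /small nd.
  have -> : delta%:C%C * (8 * A%:C%C) = (delta * (8 * A))%:C%C :> C.
    by rewrite !rmorphM rmorph_nat.
  rewrite -(rmorph1 (real_complex R)) lecR -ler_pdivlMr// mul1r.
  by rewrite /delta !ge_min lexx !orbT.
- by rewrite /delta ge_min lexx.
Qed.

Lemma neg_subspace0 b e k rho : 0 < rho -> neg_subspace b e k 0 rho.
Proof.
move=> rho0; have [delta [d0 d1 d2 _]] := small_imaginary rho0 ltr01.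
exists 1%N, (fun=> Complex 0 delta), (fun=> fun=> 0), 1; split=> //.
  by move=> i; exact: linfunc0.
move=> y; rewrite /sumsq big_ord0 mulr0 oppr0 /qform big1 ?mulr0// => i _.
by rewrite big1// => j _; rewrite !mul0r.
Qed.

Lemma neg_subspaceK e k r rho :
  neg_subspace true (e * alpha k) k.+1 r rho -> neg_subspace false e k r rho.
Proof.
case=> n [z [L [c [n0 c0 zP LL H]]]].
have rel i := small_tail_lim_rel A_gt0 alpha_le k (let: And3 _ _ zs := zP i in zs).
have tau0 i : t k (z i) / (alpha k)%:C%C != 0.
  rewrite mulf_neq0 ?invr_eq0 ?realC_neq0//.
  by have [_ _ zs] := zP i; exact: (small_tail_lim_neq0 A_gt0 alpha_le alpha_neq0).
exists n, z, (fun y i => (t k (z i) / (alpha k)%:C%C)^-1 * L y i), c; split=> //.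
  by move=> i; apply: linfuncZ.
move=> y; rewrite /shift_kernel (qform_pickK (realC_neq0 (alpha_neq0 k)) (realC_real _) rel).
rewrite mulrA -rmorphM; apply: le_trans (H y).
rewrite le_eqVlt; apply/orP; left; apply/eqP; congr (_ * _).
by apply: qform_ext => i; rewrite mulrC mulVKf.
Qed.

(** One splits off the square of a functional [y0], for which the coefficient
    of the new point is a free variable: it is used as an additional coordinate if
    the sign [e * alpha k] is negative, and to make the square vanish otherwise. *)
Lemma neg_subspaceL e k r rho : 0 < rho ->
  neg_subspace false (e * alpha k) k.+1 r rho ->
  neg_subspace true e k ((e * alpha k < 0)%R + r) rho.
Proof.
move=> rho0; set ea := e * alpha k; case=> n [z [L [c [n0 c0 zP LL H]]]].
(* The new coordinate y0, if there is one, and the remaining ones tl; the factor 2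
   leaves room for the error of the perturbation. *)
have [y0 [tl [c' [y0L tlL c'0 key]]]] : exists (y0 : (nat -> C) -> C)
    (tl : (nat -> C) -> nat -> C) (c' : R),
  [/\ linfunc ((ea < 0)%R + r) y0,
      forall phi, linfunc r phi -> linfunc ((ea < 0)%R + r) (fun y => phi (tl y)),
      0 < c' &
      forall y, ea%:C%C * `|y0 y| ^+ 2 - c%:C%C * sumsq r (tl y) <=
        - ((c' *+ 2)%:C%C * sumsq ((ea < 0)%R + r) y)].
  case: (ltP ea 0) => ea0.
    rewrite add1n; exists (fun y => y 0%N), (fun y l => y l.+1), (Num.min (- ea) c / 2).
    split.
    - exact: linfunc_head.
    - by move=> phi; exact: linfunc_behead.
    - by rewrite divr_gt0// lt_min oppr_gt0 ea0.
    move=> y; rewrite [sumsq r.+1 y]big_ord_recl /= -[_ *+ 2]mulr_natr divfK//.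
    rewrite mulrDr opprD; apply: lerD.
      rewrite -mulNr; apply: ler_wpM2r; first exact: exprn_ge0.
      by rewrite -rmorphN lecR lerNr ge_min lexx.
    rewrite lerN2; apply: ler_wpM2r; first exact: (sumsq_ge0 r (fun l => y l.+1)).
    by rewrite lecR ge_min lexx orbT.
  rewrite add0n; exists (fun=> 0), id, (c / 2); split=> //.
  - exact: linfunc0.
  - by rewrite divr_gt0.
  by move=> y; rewrite normr0 expr0n mulr0 sub0r -[_ *+ 2]mulr_natr divfK.
set r' := ((ea < 0)%R + r)%N in y0L tlL key *.
have zU i : upper_half (z i) by have [] := zP i.
have z0 i : z i != 0.
  apply/eqP => zi; have := zU i; rewrite /upper_half /= zi /= ltxx; exact/negP.
pose xi y i := L (tl y) i.
have xiL i : linfunc r' (fun y => xi y i) by apply: (tlL (fun y => L y i)); exact: LL.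
(* The coefficient of the new point which gives the split off functional the
   value y0. *)
pose om y := y0 y + -1 * \sum_i (z i)^-1 * xi y i.
have omL : linfunc r' om.
  apply: linfuncD => //; apply: linfuncZ; apply: linfunc_sum => i.
  exact: linfuncZ.
pose T : C := 2 * A%:C%C.
have T0 : 0 <= T by rewrite mulr_ge0// ler0c ltW.
have [M M0 HM] : exists2 M : R, 0 <= M & forall y,
    \sum_j (`|om y| ^+ 2 + `|xi y j| ^+ 2) * (T *+ 2 / (complex.Im (z j))%:C%C)
    + `|om y| ^+ 2 * (T *+ 2) <= M%:C%C * sumsq r' y.
  have [||_ /ge0_complex[M M0 ->] HM] :=
    @error_bound _ _ _ _ _ (fun j => T *+ 2 / (complex.Im (z j))%:C%C) (T *+ 2) omL xiL.
  - by move=> i; rewrite divr_ge0 ?mulrn_wge0// ler0c ltW//; exact: zU.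
  - by rewrite mulrn_wge0.
  by exists M.
have m0 : 0 < c' / (`|ea| * M + 1).
  by rewrite divr_gt0// ltr_wpDl// mulr_ge0.
have [delta [d0 d1 d2 d3]] := small_imaginary rho0 m0.
have [w0 w0E] : exists w0 : C, w0 = Complex 0 delta by eexists.
rewrite -w0E in d1 d2.
have w0U : upper_half w0 by rewrite w0E.
have w00 : w0 != 0.
  by apply/eqP => wz; move: w0U; rewrite /upper_half wz /= ltxx.
pose zz := fcons w0 z.
have zzP i : [/\ upper_half (zz i), `|zz i| < rho%:C%C & small A (zz i)].
  by rewrite /zz /fcons; case: unliftP.
have zz0 i : zz i != 0 by rewrite /zz /fcons; case: unliftP.
have rel i := small_tail_lim_rel A_gt0 alpha_le k (let: And3 _ _ zs := zzP i in zs).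
have tau0 i : t k (zz i) / (alpha k)%:C%C != 0.
  rewrite mulf_neq0 ?invr_eq0 ?realC_neq0//.
  by have [_ _ zs] := zzP i; exact: (small_tail_lim_neq0 A_gt0 alpha_le alpha_neq0).
pose v y := fcons (w0 * om y) (xi y).
exists n.+1, zz, (fun y i => (t k (zz i) / (alpha k)%:C%C * zz i)^-1 * v y i), c'.
split=> //.
  move=> i; apply: linfuncZ; rewrite /v /fcons.
  case: (unlift ord0 i) => [j|]; [exact: xiL|exact: linfuncZ].
move=> y; rewrite /shift_kernel.
have zzc i j : zz i - (zz j)^* != 0.
  by have [[zi _ _] [zj _ _]] := (zzP i, zzP j); exact: upper_sub_conj.
rewrite (qform_pickL zzc (realC_neq0 (alpha_neq0 k)) (realC_real _) rel).
have cancel1 (a b x : C) : a != 0 -> b != 0 -> (a * b)^-1 * x * a = b^-1 * x.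
  by move=> a0 b0; field; rewrite a0 b0.
have cancel2 (a b x : C) : a != 0 -> b != 0 -> (a * b)^-1 * x * a * b = x.
  by move=> a0 b0; field; rewrite a0 b0.
have -> : \sum_i (t k (zz i) / (alpha k)%:C%C * zz i)^-1 * v y i *
    (t k (zz i) / (alpha k)%:C%C) = y0 y.
  transitivity (\sum_i (zz i)^-1 * v y i).
    by apply: eq_bigr => i _; exact: cancel1 (tau0 i) (zz0 i).
  rewrite big_ord_recl /zz /v !fcons0; under eq_bigr do rewrite !fconsS.
  by rewrite mulKf// /om mulN1r subrK.
rewrite (@qform_ext _ _ _ _ (v y)); last first.
  by move=> i; exact: cancel2 (tau0 i) (zz0 i).
rewrite (@eq_qform _ _ _ (pick_kernel (fcons w0 z)
   (fcons (t k.+1 w0) (fun i => t k.+1 (z i))))); last first.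
  move=> i j; rewrite /pick_kernel -/zz.
  have e1 l : t k.+1 (zz l) = fcons (t k.+1 w0) (fun i => t k.+1 (z i)) l.
    by rewrite /zz /fcons; case: unliftP.
  by rewrite !e1.
rewrite mulrA -rmorphM -/ea mulrDr.
have err := @add_point R n z (fun i => t k.+1 (z i)) T zU _ T0 delta w0 (t k.+1 w0)
  (om y) (xi y) d0 w0E _.
have {}err := err (fun i => small_tail_lim_le A_gt0 alpha_le k.+1
   (let: And3 _ _ zs := zP i in zs)) (small_tail_lim_le A_gt0 alpha_le k.+1 d2).
move: err; rewrite -/(v y).
have Hy := H (tl y); rewrite -/(xi y) /shift_kernel in Hy.
set X := qform _ (v y); set Y := qform _ (xi y) in Hy *; move=> err.
have Xr : X \is Num.real by apply: qform_real => i j; exact: pick_herm.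
have Yr : Y \is Num.real by apply: qform_real => i j; exact: pick_herm.
have S0 := sumsq_ge0 r' y.
have -> : ea%:C%C * `|y0 y| ^+ 2 + ea%:C%C * X =
  (ea%:C%C * `|y0 y| ^+ 2 + ea%:C%C * Y) + ea%:C%C * (X - Y) by ring.
apply: (@le_trans _ _ (- ((c' *+ 2)%:C%C * sumsq r' y) + c'%:C%C * sumsq r' y)); last first.
  by rewrite rmorphMn mulr2n mulrDl opprD subrK.
apply: lerD.
  by apply: le_trans (key y); apply: lerD.
apply: le_trans (real_ler_norm _) _.
  by rewrite realM ?realB ?realC_real.
rewrite normrM; apply: (@le_trans _ _ (`|ea%:C%C| * (delta%:C%C * (M%:C%C * sumsq r' y)))).
  apply: ler_wpM2l => //; apply: le_trans err _; apply: ler_wpM2l => //.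
  by rewrite ler0c ltW.
rewrite !mulrA; apply: ler_wpM2r => //.
have -> : `|ea%:C%C| = `|ea|%:C%C :> C.
  by rewrite normc_def /= expr0n addr0 sqrtr_sqr.
rewrite -!rmorphM lecR mulrAC.
apply: (@le_trans _ _ ((`|ea| * M + 1) * (c' / (`|ea| * M + 1)))).
  by apply: ler_pM => //; rewrite ?mulr_ge0 ?(ltW d0)// lerDl.
by rewrite mulrC divfK// gt_eqF// ltr_wpDl// mulr_ge0.
Qed.

Lemma neg_subspace_nneg d b k e rho : 0 < rho ->
  neg_subspace b e k (nneg alpha b e k d) rho.
Proof.
move=> rho0; elim: d b k e => [|d IH] b k e; first exact: neg_subspace0.
rewrite /=; case: b => /=; first exact/neg_subspaceL.
by rewrite add0n; apply: neg_subspaceK.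
Qed.

End LowerBound.

(** * Counting signs *)

Section Signs.
Variables (R : realType) (alpha : nat -> R).
Hypothesis alpha_neq0 : forall k, alpha k != 0.

Lemma nnegE b e k d : nneg alpha b e k d =
  (\sum_(i < d) ((b (+) odd i) && (e * \prod_(k <= j < k + i.+1) alpha j < 0)%R))%N.
Proof.
elim: d b e k => [|d IH] b e k; first by rewrite big_ord0.
have ek : \prod_(k <= j < k + 1) alpha j = alpha k by rewrite addn1 big_nat1.
rewrite /= IH big_ord_recl /= addbF ek; congr addn.
apply: eq_bigr => i _; rewrite /bump leq0n add0n add1n addbN addNb.
have -> : (k + i.+2 = k.+1 + i.+1)%N by lia.
by rewrite [in RHS]big_ltn ?mulrA//; lia.
Qed.

Lemma nneg_addb e k d : (nneg alpha false e k d + nneg alpha true e k d)%N =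
  (\sum_(i < d) (e * \prod_(k <= j < k + i.+1) alpha j < 0)%R)%N.
Proof.
rewrite !nnegE -big_split; apply: eq_bigr => i _ /=.
by case: (odd i); rewrite /= ?addn0.
Qed.

Lemma sum_unbounded (P : nat -> bool) :
  (forall N, exists2 i, (N <= i)%N & P i) ->
  forall K, exists d, (K <= \sum_(i < d) P i)%N.
Proof.
move=> H; elim=> [|K [d Kd]]; first by exists 0%N.
have [i di Pi] := H d; exists i.+1; rewrite big_ord_recr /= Pi addn1 ltnS.
by apply: leq_trans Kd _; rewrite -(subnKC di) big_split_ord leq_addr.
Qed.

Lemma sum_even (P : nat -> bool) m :
  (\sum_(i < m.*2.+1) (~~ odd i && P i.+1) = \sum_(i < m) P i.*2.+1 + P m.*2.+1)%N.
Proof.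
elim: m => [|m IH]; first by rewrite big_ord_recl !big_ord0 /= addn0.
rewrite doubleS 2!big_ord_recr IH [in RHS]big_ord_recr /=.
by rewrite !negbK odd_double addn0 -doubleS.
Qed.

Lemma sum_odd (P : nat -> bool) m :
  (\sum_(i < m.*2.+1) (odd i && P i.+1) = \sum_(i < m) P i.*2.+2)%N.
Proof.
elim: m => [|m IH]; first by rewrite big_ord_recl !big_ord0 /= addn0.
rewrite doubleS 2!big_ord_recr IH [in RHS]big_ord_recr /=.
by rewrite !negbK odd_double addn0.
Qed.

Lemma count_map_iota (P : nat -> bool) (f : nat -> nat) m :
  count P [seq f i | i <- iota 0 m] = (\sum_(i < m) P (f i))%N.
Proof.
rewrite count_map -sum1_count big_mkcond /= -{1}(subn0 m) big_mkord.
by apply: eq_bigr => i _; case: (P _).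
Qed.

Lemma sign_tailE m j i : (j <= i)%N -> (i <= m.*2.+1)%N ->
  sign_tail alpha m j * Num.sg (\prod_(j <= k < i) alpha k) = sign_tail alpha m i.
Proof.
move=> ji im; rewrite /sign_tail (big_cat_nat ji im) /= sgrM mulrAC -sgrM.
rewrite -expr2 sgrX sqr_sg prodf_seq_neq0 /= (_ : all _ _) ?mul1r//.
by apply/allP => k _ /=.
Qed.

(** The sign of the whole product times that of an initial part is the sign of
    the complementary part, because squares of signs are 1. *)
Lemma sign_tail_lt0 m i : (i <= m.*2.+1)%N ->
  (sign_tail alpha m 0 * \prod_(0 <= k < i) alpha k < 0) = (sign_tail alpha m i < 0).
Proof.
move=> im; rewrite -(sign_tailE (leq0n i) im) -sgr_lt0 sgrM.
by rewrite [Num.sg (sign_tail _ _ _)]sgr_id.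
Qed.

Lemma nneg_lambda m : nneg alpha true (sign_tail alpha m 0) 0 m.*2.+1 =
  count (fun j => sign_tail alpha m j < 0) [seq i.*2.+1 | i <- iota 0 m].
Proof.
rewrite nnegE count_map_iota.
transitivity (\sum_(i < m.*2.+1) (~~ odd i && (sign_tail alpha m i.+1 < 0)%R))%N.
  by apply: eq_bigr => i _; rewrite add0n sign_tail_lt0.
rewrite (sum_even (fun j => sign_tail alpha m j < 0)).
by rewrite {2}/sign_tail big_geq// sgr1 ltr10 addn0.
Qed.

Lemma nneg_kappa m : nneg alpha false (sign_tail alpha m 0) 0 m.*2.+1 =
  count (fun j => sign_tail alpha m j < 0) [seq i.*2.+2 | i <- iota 0 m].
Proof.
rewrite nnegE count_map_iota.
transitivity (\sum_(i < m.*2.+1) (odd i && (sign_tail alpha m i.+1 < 0)%R))%N.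
  by apply: eq_bigr => i _; rewrite add0n sign_tail_lt0.
exact: (sum_odd (fun j => sign_tail alpha m j < 0)).
Qed.

Lemma prod_alpha_neq0 i j : \prod_(i <= k < j) alpha k != 0.
Proof. by rewrite prodf_seq_neq0; apply/allP => k _ /=. Qed.

Lemma sign_tail_prod_gt0 m i : (forall n, (m.*2 < n)%N -> 0 < alpha n) ->
  (m.*2 < i)%N -> 0 < sign_tail alpha m 0 * \prod_(0 <= k < i) alpha k.
Proof.
move=> pos mi; rewrite (big_cat_nat (leq0n m.*2.+1) mi) /= mulrA.
apply: mulr_gt0; last first.
  rewrite big_seq; apply: prodr_gt0 => k.
  by rewrite mem_index_iota => /andP[mk _]; exact: pos.
by rewrite /sign_tail -normrEsg normr_gt0 prod_alpha_neq0.
Qed.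

Lemma cvg_prod_sg m j : (forall n, (m.*2 < n)%N -> 0 < alpha n) ->
  (j <= m.*2)%N ->
  (\prod_(j <= k < n) Num.sg (alpha k)) @[n --> \oo] --> sign_tail alpha m j.
Proof.
move=> pos jm; apply: cvg_near_cst; exists m.*2.+1 => // n /= mn.
rewrite /sign_tail (big_morph _ (@sgrM R) (@sgr1 R)).
rewrite (big_cat_nat _ mn) /=; last exact: leqW.
rewrite [X in _ * X]big1_seq ?mulr1// => k /=.
by rewrite mem_index_iota => /andP[mk _]; rewrite gtr0_sg// pos.
Qed.

End Signs.

(** * Membership in the classes *)

Section PickSignature.
Variables (R : realType) (alpha : nat -> R) (A : R).
Local Notation C := (R[i]).
Hypothesis A_gt0 : 0 < A.
Hypothesis alpha_le : forall k, `|alpha k| <= A.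
Hypothesis alpha_neq0 : forall k, alpha k != 0.

Lemma qform_pick_matrix b (e : R) n (z : 'I_n -> C) (g : C -> C) (f x : 'I_n -> C) :
  (forall i, g (z i) = if b then z i * (e%:C%C * f i) else e%:C%C * f i) ->
  qform (pick_matrix g z) x = e%:C%C * qform (shift_kernel b z f) x.
Proof.
move=> gE; rewrite -qformZ; apply: eq_qform => i j.
rewrite mxE /shift_kernel /pick_kernel !gE [RHS]mulrA; congr (_ / _).
by case: b {gE}; rewrite !rmorphM /= conj_realC; ring.
Qed.

(** Only the values of [g] near 0 matter, so this bounds from below the number
    of negative squares of every continuation. *)
Lemma pick_lower b (e : R) (g : C -> C) d :
  (\forall z \near (0 : R[i]^o), nonreal z ->
     g z = if b then z * (e%:C%C * cfrac alpha z) else e%:C%C * cfrac alpha z) ->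
  exists n (z : 'I_n -> C), admissible g z /\
    (nneg alpha b e 0 d <= num_neg_eigenvalues (pick_matrix g z))%N.
Proof.
move=> g0.
have [rho rho0 rhoP] : exists2 rho : R, 0 < rho & forall z : C, `|z| < rho%:C%C ->
    small A z /\ (nonreal z ->
     g z = if b then z * (e%:C%C * cfrac alpha z) else e%:C%C * cfrac alpha z).
  have : \forall z \near (0 : R[i]^o), small A z /\ (nonreal z ->
     g z = if b then z * (e%:C%C * cfrac alpha z) else e%:C%C * cfrac alpha z).
    exact: (filterI (small_near A_gt0) g0).
  move=> /nbhs_ballP[r /= /gt0_complex[rho rho0 ->] H].
  by exists rho => // z zr; apply: H; rewrite -ball_normE /= sub0r normrN.
have [n [z [L [c [n0 c0 zP LL H]]]]] :=
  neg_subspace_nneg A_gt0 alpha_le alpha_neq0 d b 0 e rho0.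
have zU i : upper_half (z i) by have [] := zP i.
have gE i : g (z i) = if b then z i * (e%:C%C * cfrac alpha (z i))
    else e%:C%C * cfrac alpha (z i).
  by have [_ zr _] := zP i; apply: (rhoP _ zr).2; exact: upper_nonreal.
exists n, z; split.
  split=> // k; split=> //.
  apply: (@bounded_not_pole _ _ _ ((1 + rho%:C%C) * (`|e%:C%C| * (2 * A%:C%C)))).
  apply: dnbhs_nbhs.
  have near1 : \forall w \near (z k : R[i]^o), `|w| < rho%:C%C.
    have [_ zr _] := zP k.
    have e0 : 0 < rho%:C%C - `|z k| by rewrite subr_gt0.
    apply: filterS (ccvg_near (@ccvg_id R (z k)) e0) => w.
    rewrite ltrBrDl => /(le_lt_trans _); apply.
    by rewrite -{1}(subrK (z k) w) addrC (le_trans (ler_normD _ _))// distrC.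
  apply: filterS (filterI near1 (nonreal_near (upper_nonreal (zU k)))) => w [wr wN].
  have [ws ->] := rhoP _ wr; last exact: wN.
  have tl : `|cfrac alpha w| <= 2 * A%:C%C by exact: (small_tail_lim_le A_gt0 alpha_le 0 ws).
  have r0 : 0 <= (rho%:C%C : C) by rewrite ler0c ltW.
  case: ifP => _; rewrite !normrM.
    apply: ler_pM; rewrite ?mulr_ge0//; last by apply: ler_wpM2l.
    by apply: le_trans (ltW wr) _; rewrite lerDr.
  rewrite -[X in X <= _]mul1r; apply: ler_pM; rewrite ?mulr_ge0//.
    by rewrite lerDl.
  by apply: ler_wpM2l.
have [u uE] := choice LL.
apply: (@num_neg_ge _ _ _ _ (fun l i => u i l)); first exact: pick_matrix_herm.
move=> y [l0 yl0].
pose y' (l : nat) := oapp y 0 (insub l : option 'I_(nneg alpha b e 0 d)).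
have y'E (l : 'I_(nneg alpha b e 0 d)) : y' l = y l by rewrite /y' valK.
rewrite (qform_pick_matrix _ gE).
rewrite (@qform_ext _ _ _ _ (L y')); last first.
  by move=> i; rewrite uE; apply: eq_bigr => l _; rewrite y'E.
apply: le_lt_trans (H y') _; rewrite oppr_lt0 mulr_gt0 ?realC_gt0//.
rewrite /sumsq lt_neqAle sumsq_ge0 andbT eq_sym psumr_neq0; last first.
  by move=> l _; rewrite exprn_ge0.
apply/hasP; exists l0; first exact: mem_index_enum.
by rewrite /= y'E exprn_gt0// normr_gt0.
Qed.

End PickSignature.

Section PositiveTailClass.
Variables (R : realType) (alpha : nat -> R) (A : R) (E : nat) (e : R).
Local Notation C := (R[i]).
Hypothesis A_gt0 : 0 < A.
Hypothesis alpha_le : forall k, `|alpha k| <= A.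
Hypothesis alpha_neq0 : forall k, alpha k != 0.
Hypothesis alpha_pos : forall k, (E <= k)%N -> 0 < alpha k.
Hypothesis oddE : odd E.
Hypothesis e_pos : 0 < e * \prod_(0 <= i < E) alpha i.

Definition continuation (z : C) : C := cfnum alpha z 0 E / cfden alpha z 0 E.

Lemma nonreal_neq0 (z : C) : nonreal z -> z != 0.
Proof. by move=> zN; apply/eqP => z0; move: zN; rewrite /nonreal z0 /= eqxx. Qed.

Let num_der a (aN : nonreal a) :=
  (numden_derivable alpha_pos alpha_le aN (add0n E)).1.
Let den_der a (aN : nonreal a) :=
  (numden_derivable alpha_pos alpha_le aN (add0n E)).2.
Let den_iso a (aN : nonreal a) :=
  den_isolated alpha_neq0 alpha_pos alpha_le e_pos oddE aN.

Lemma e_neq0 : e != 0.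
Proof. by apply: contraTneq e_pos => ->; rewrite mul0r ltxx. Qed.

Lemma continuation_near0 :
  \forall z \near (0 : R[i]^o), nonreal (z : C) -> continuation z = cfrac alpha z.
Proof.
apply: filterS (small_near A_gt0) => z zs _.
have [d0 nE] := small_numden A_gt0 alpha_le alpha_neq0 0 E zs.
by rewrite /continuation nE mulfK.
Qed.

(** With [c] constant and with [c z] proportional to [z] this covers the two
    functions whose classes are to be found. *)
Lemma multiple_meromorphic (c : C -> C) :
  (forall a, nonreal a -> derivable (c : R[i]^o -> R[i]^o) a 1) ->
  (forall a, nonreal a -> c a != 0) ->
  meromorphic_on (@nonreal R) (fun z => c z * continuation z) /\
  forall a, nonreal a -> ~ pole (fun z => c z * continuation z) a ->
    cfden alpha a 0 E != 0.
Proof.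
move=> c_der c0.
have -> : (fun z => c z * continuation z) =
    (fun z => (c z * cfnum alpha z 0 E) / cfden alpha z 0 E).
  by apply/funext => z; rewrite /continuation mulrA.
have p_der a (aN : nonreal a) := cderivableM (c_der _ aN) (num_der aN).
have pq0 a : nonreal a -> cfden alpha a 0 E = 0 -> c a * cfnum alpha a 0 E != 0.
  move=> aN d0; rewrite mulf_neq0 ?c0//.
  by rewrite (num_neq0 alpha_neq0 (nonreal_neq0 aN)).
split; first exact: (quotient_meromorphic p_der den_der pq0 den_iso).
move=> a aN npole; apply/eqP => d0; apply: npole.
exact: (quotient_pole p_der den_der pq0 den_iso aN d0).
Qed.

Lemma continuation_conj (z : C) : nonreal z -> continuation z^* = (continuation z)^*.
Proof.
move=> zN; rewrite /continuation.
have [-> ->] := numden_conj alpha_pos alpha_le zN (add0n E).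
by rewrite fmorph_div.
Qed.

Lemma pick_upper b n (z : 'I_n -> C) (g : C -> C) :
  (forall z, g z = if b then z * (e%:C%C * continuation z) else e%:C%C * continuation z) ->
  (forall i, upper_half (z i)) -> (forall i, cfden alpha (z i) 0 E != 0) ->
  (num_neg_eigenvalues (pick_matrix g z) <= nneg alpha b e 0 E)%N.
Proof.
move=> gE zU d0.
have zz i j : z i - (z j)^* != 0 by exact: upper_sub_conj.
have [V [G [G0 HV]]] := hkernel_lower zz E 0 b e alpha_neq0.
pose q i := cfden alpha (z i) 0 E.
apply: (@num_neg_le _ _ _ _ (fun l i => (q i)^-1 * V l i)).
  exact: pick_matrix_herm.
move=> x xV.
rewrite (@qform_pick_matrix R b e n z g (fun i => continuation (z i))); last first.
  by move=> i; exact: gE.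
have -> : qform (shift_kernel b z (fun i => continuation (z i))) x =
   qform (hkernel b z (fun i => cfnum alpha (z i) 0 E)
     (fun i => cfden alpha (z i) 0 E)) (fun i => x i * (q i)^-1).
  rewrite -qform_congr; apply: eq_qform => i j.
  rewrite /shift_kernel /pick_kernel /hkernel /continuation -/(q i) -/(q j) [RHS]mulrA.
  have [qi qj] := (d0 i, d0 j); rewrite -/(q i) -/(q j) in qi qj.
  congr (_ / _); case: ifP => _; rewrite !(rmorphM, fmorphV, rmorph1) /=.
    by field; rewrite qi conjC_eq0 qj.
  by field; rewrite qi conjC_eq0 qj.
apply: le_trans (HV (fun i => x i * (q i)^-1) _); last first.
  by move=> l lV; rewrite -[RHS](xV (Ordinal lV)); apply: eq_bigr => i _; rewrite mulrA.
rewrite add0n; apply: mulr_ge0; first by rewrite ler0c ltW.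
exact: (hkernel_psd alpha_pos alpha_le).
Qed.

Lemma continuation_class b (g : C -> C) :
  (forall z, g z = if b then z * (e%:C%C * continuation z) else e%:C%C * continuation z) ->
  nevanlinna (nneg alpha b e 0 E) g.
Proof.
move=> gE.
pose c (z : C) : C := if b then z * e%:C%C else e%:C%C.
have gc : g = (fun z => c z * continuation z).
  by apply/funext => z; rewrite gE /c; case: ifP => _; rewrite ?mulrA.
have e0 : e%:C%C != 0 :> C by rewrite realC_neq0 ?e_neq0.
have [|a aN|mero dn0] := @multiple_meromorphic c.
- move=> a aN; rewrite /c; case: (b); last exact: cderivable_cst.
  exact: (cderivableM (@cderivable_id R _) (@cderivable_cst R _ _)).
- by rewrite /c; case: ifP => _ //; apply: mulf_neq0 => //; exact: nonreal_neq0.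
rewrite -gc in mero dn0.
have upper n (z : 'I_n -> C) : admissible g z ->
    (num_neg_eigenvalues (pick_matrix g z) <= nneg alpha b e 0 E)%N.
  move=> [_ zP]; apply: pick_upper => // i; have [zU np] := zP i => //.
  by apply: dn0 => //; exact: upper_nonreal.
split=> //.
- exact: meromorphic_upper.
- move=> z zU _; rewrite !gE continuation_conj; last exact: upper_nonreal.
  by case: ifP => _; rewrite !rmorphM /= conj_realC.
have [|n [z [adm le]]] := @pick_lower R alpha A A_gt0 alpha_le alpha_neq0 b e g E.
  by apply: filterS continuation_near0 => z H zN; rewrite gE H.
by exists n, z; split=> //; apply/eqP; rewrite eqn_leq upper.
Qed.

End PositiveTailClass.

Section Exclusion.
Variables (R : realType) (alpha : nat -> R) (A : R).
Local Notation C := (R[i]).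
Hypothesis A_gt0 : 0 < A.
Hypothesis alpha_le : forall k, `|alpha k| <= A.
Hypothesis alpha_neq0 : forall k, alpha k != 0.

Lemma nevanlinna_nneg_le b (e : R) (f g : C -> C) kappa d :
  cfrac_continuation alpha f ->
  (forall z, g z = if b then z * (e%:C%C * f z) else e%:C%C * f z) ->
  nevanlinna kappa g -> (nneg alpha b e 0 d <= kappa)%N.
Proof.
move=> [_ f0] gE [_ _ le _].
have [|n [z [adm H]]] := @pick_lower R alpha A A_gt0 alpha_le alpha_neq0 b e g d.
  by apply: filterS f0 => z H zN; rewrite gE H.
exact: leq_trans H (le _ _ adm).
Qed.

Lemma cfrac_in_sign_tail m : (forall n, (m.*2 < n)%N -> 0 < alpha n) ->
  let eps := sign_tail alpha m in
  cfrac_in alpha (eps 0%N) (nevanlinna2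
    (count (fun j => eps j < 0) [seq i.*2.+2 | i <- iota 0 m])
    (count (fun j => eps j < 0) [seq i.*2.+1 | i <- iota 0 m])).
Proof.
move=> pos eps.
have oE : odd m.*2.+1 by rewrite /= odd_double.
have e_pos := sign_tail_prod_gt0 alpha_neq0 pos (ltnSn m.*2).
exists (continuation alpha m.*2.+1); split.
  split; last exact: (continuation_near0 _ A_gt0 alpha_le alpha_neq0).
  have [+ _] := multiple_meromorphic alpha_le alpha_neq0 pos oE e_pos (c := fun=> 1)
    (fun a _ => @cderivable_cst R _ _) (fun _ _ => oner_neq0 _).
  by have -> : (fun z => 1 * continuation alpha m.*2.+1 z) = continuation alpha m.*2.+1
    by apply/funext => z; rewrite mul1r.
rewrite /nevanlinna2 -(nneg_kappa alpha_neq0) -(nneg_lambda alpha_neq0); split.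
  exact: (continuation_class A_gt0 alpha_le alpha_neq0 pos oE e_pos (b := false)).
exact: (continuation_class A_gt0 alpha_le alpha_neq0 pos oE e_pos (b := true)).
Qed.

Lemma cfrac_not_in_opp m : (forall n, (m.*2 < n)%N -> 0 < alpha n) ->
  ~ cfrac_in alpha (- sign_tail alpha m 0) (@nevanlinna_fin R).
Proof.
move=> pos [f [fc [kappa Nk]]].
set e := - sign_tail alpha m 0 in Nk.
have [|d] := @sum_unbounded (fun i => odd i && (e * \prod_(0 <= k < i.+1) alpha k < 0)) _
  kappa.+1.
  move=> N; exists (N + m).*2.+1; first lia.
  rewrite /= odd_double /= /e mulNr oppr_lt0.
  by apply: (sign_tail_prod_gt0 alpha_neq0 pos); lia.
rewrite leqNgt ltnS; apply/negP; rewrite negbK.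
have := nevanlinna_nneg_le d fc (b := false) (fun=> erefl) Nk.
by rewrite nnegE.
Qed.

(** Each negative coefficient changes the sign of the product, so for either
    sign of [e] infinitely many products have the wrong sign; they are distributed
    among the counts for the function and for its multiple by [z]. *)
Lemma cfrac_not_in_of_neg (e : R) : e != 0 ->
  (forall N, exists n, (N <= n)%N /\ alpha n < 0) ->
  ~ cfrac_in alpha e (@nevanlinna2_fin R).
Proof.
move=> e0 neg [f [fc [kappa [lambda [Nk Nl]]]]].
have [|d] := @sum_unbounded (fun i => e * \prod_(0 <= k < i.+1) alpha k < 0) _
  (kappa + lambda).+1.
  move=> N; have [[|n] [Nn an]] := neg N.+1; first by [].
  set p := e * \prod_(0 <= k < n.+1) alpha k.
  have p0 : p != 0 by rewrite mulf_neq0 ?prod_alpha_neq0.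
  have [pn|pp] := ltP p 0; first by exists n.
  exists n.+1; first exact: ltnW.
  have p_gt0 : 0 < p by rewrite lt_neqAle eq_sym p0.
  by rewrite big_nat_recr//= mulrA pmulr_rlt0.
rewrite leqNgt ltnS; apply/negP; rewrite negbK.
have := leq_add (nevanlinna_nneg_le d fc (b := false) (fun=> erefl) Nk)
  (nevanlinna_nneg_le d fc (b := true) (fun=> erefl) Nl).
by rewrite nneg_addb.
Qed.

End Exclusion.

Theorem theorem3p16 (R : realType) (alpha : nat -> R)
    (alpha_neq0 : forall n, alpha n != 0)
    (alpha_bounded : has_ubound (range (fun n => `|alpha n|))) :
  (forall m : nat, (0 < m)%N ->
     (forall n, (m.*2 < n)%N -> 0 < alpha n) ->
     let eps := sign_tail alpha m in
     let lambda :=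
       count (fun j => eps j < 0) [seq i.*2.+1 | i <- iota 0 m] in
     let kappa :=
       count (fun j => eps j < 0) [seq i.*2.+2 | i <- iota 0 m] in
     [/\ forall j, (j <= m.*2)%N ->
           (\prod_(j <= k < n) Num.sg (alpha k)) @[n --> \oo] --> eps j,
         cfrac_in alpha (eps 0%N) (nevanlinna2 kappa lambda)
       & ~ cfrac_in alpha (- eps 0%N) (@nevanlinna_fin R)])
  /\
  ((forall eps : R, eps \in [:: -1; 1] ->
      ~ cfrac_in alpha eps (@nevanlinna2_fin R))
   <-> (forall N : nat, exists n, (N <= n)%N /\ alpha n < 0)).
Proof.
have [A A_gt0 alpha_le] : exists2 A : R, 0 < A & forall k, `|alpha k| <= A.
  have [A HA] := alpha_bounded.
  have le k : `|alpha k| <= A by apply: HA; exists k.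
  by exists A => //; apply: lt_le_trans (le 0%N); rewrite normr_gt0.
split=> [m m0 pos eps lambda kappa|].
  split.
  - by move=> j; exact: cvg_prod_sg.
  - exact: (cfrac_in_sign_tail A_gt0 alpha_le alpha_neq0 pos).
  - exact: (cfrac_not_in_opp A_gt0 alpha_le alpha_neq0 pos).
split=> [notin N|neg eps].
  apply: contrapT => H.
  have pos n : (N.+1.*2 < n)%N -> 0 < alpha n.
    move=> Nn; rewrite lt_neqAle eq_sym alpha_neq0 leNgt; apply/negP => an.
    by apply: H; exists n; split=> //; lia.
  apply: (notin (sign_tail alpha N.+1 0)).
    have : sign_tail alpha N.+1 0 != 0 by rewrite sgr_eq0 prod_alpha_neq0.
    rewrite !inE /sign_tail; case: sgrP => //.
    - by rewrite eqxx.
    - by rewrite eqxx orbT.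
    - by rewrite eqxx.
  have [f [fc fN]] := cfrac_in_sign_tail A_gt0 alpha_le alpha_neq0 pos.
  by exists f; split=> //; eexists; eexists; exact: fN.
rewrite !inE => epsE; apply: (cfrac_not_in_of_neg A_gt0 alpha_le alpha_neq0) neg.
by case/orP: epsE => /eqP->; rewrite ?oppr_eq0 oner_neq0.
Qed.
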